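(* Let $\mathbf{A}$ be the port-Hamiltonian operator associated with $(\mathbf{P}_1,\mathbf{P}_0,\mathbf{H},\mathbf{W}_B)$ on $[a,b]$ satisfying assumptions (a), (b), (c) of the context, and let $(\mathbf{T}(t))_{t\ge 0}$ be the contraction semigroup on $\mathcal{X}$ generated by $\mathbf{A}$. Then there exists $\tau>0$ such that $\|\mathbf{T}(t)\|=1$ for all $0\le t\le\tau$, where $\|\cdot\|$ is the operator norm on $\mathcal{X}$.
   Context: Let $a<b$ be real, $n\ge 1$, $\mathbb{K}=\mathbb{R}$ or $\mathbb{K}=\mathbb{C}$. For a vector or matrix $v$, $v^*$ denotes the conjugate transpose; inequalities between symmetric matrices are in the sense of quadratic forms (Loewner order). $\mathbf{0}_n,\mathbf{1}_n$ denote the $n\times n$ zero and identity matrices. Assumptions: (a) $\mathbf{W}_B\in\mathbb{R}^{n\times 2n}$ has rank $n$ and $\mathbf{W}_B\mathbf{\Sigma}\mathbf{W}_B^*\ge 0$ with $\mathbf{\Sigma}=\begin{pmatrix}\mathbf{0}_n&\mathbf{1}_n\\ \mathbf{1}_n&\mathbf{0}_n\end{pmatrix}$. (b) $\mathbf{H}\in C^1([a,b],\mathbb{R}^{n\times n})$, $\mathbf{H}(\zeta)$ is symmetric and $m\mathbf{1}_n\le\mathbf{H}(\zeta)\le M\mathbf{1}_n$ for all $\zeta\in[a,b]$, with constants $m,M>0$ independent of $\zeta$. (c) $\mathbf{P}_1\in\mathbb{R}^{n\times n}$ is symmetric and invertible, and $\mathbf{P}_0\in\mathbb{R}^{n\times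 n}$ is skew-symmetric. The port-Hamiltonian operator is $\mathbf{A}x=\mathbf{P}_1\frac{\partial}{\partial\zeta}(\mathbf{H}x)+\mathbf{P}_0\mathbf{H}x$ with domain $$D(\mathbf{A})=\left\{x\in L^2([a,b],\mathbb{K}^n)\ \middle|\ \mathbf{H}x\in H^1([a,b],\mathbb{K}^n),\ \mathbf{W}_B\begin{pmatrix}\mathbf{e}_\partial\\ \mathbf{f}_\partial\end{pmatrix}=0\right\},\qquad \begin{pmatrix}\mathbf{e}_\partial\\ \mathbf{f}_\partial\end{pmatrix}=\frac{1}{\sqrt2}\begin{pmatrix}\mathbf{1}_n&\mathbf{1}_n\\ \mathbf{P}_1&-\mathbf{P}_1\end{pmatrix}\begin{pmatrix}(\mathbf{H}x)(b)\\ (\mathbf{H}x)(a)\end{pmatrix}.$$ The state space is $\mathcal{X}=L^2([a,b],\mathbb{K}^n)$ with inner product $\langle f,g\rangle_{\mathcal{X}}=\frac12\int_a^b g(\zeta)^*\mathbf{H}(\zeta)f(\zeta)\,\mathrm{d}\zeta$ and induced norm $\|\cdot\|_{\mathcal{X}}$. Under (a)-(c) it is known that $\mathbf{A}$ generates a contraction semigroup $(\mathbf{T}(t))_{t\ge0}$ on $\mathcal{X}$. *)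

(* Defs.v *)
From mathcomp Require Export all_boot all_order all_algebra.
From mathcomp Require Export complex.
From mathcomp Require Export all_classical all_reals all_analysis.

Set Implicit Arguments.
Unset Strict Implicit.
Unset Printing Implicit Defensive.

Import Order.TTheory GRing.Theory Num.Theory.
Import numFieldTopology.Exports numFieldNormedType.Exports.

Local Open Scope classical_set_scope.
Local Open Scope ring_scope.

(* A space of classes is handled through representatives: [F] is the space of
   representatives, [X] the admissible ones, [eqv] the relation that identifies
   representatives of one class and [nrm] the norm, read on representatives.
   The scalars are the elements of [K], a subfield of the complex numbers.
   An operator on the quotient is given by a map [F -> F] that is compatible
   with [eqv] on [X]; its values outside of [X] are irrelevant. *)
Section Semigroup.
Context (R : realType) (F : lmodType R[i]).
Variables (K : set R[i]) (X : set F) (eqv : F -> F -> Prop) (nrm : F -> R).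

Record bounded_operator (S : F -> F) : Prop := BoundedOperator {
  bop_stable : forall f, X f -> X (S f);
  bop_compat : forall f g, X f -> X g -> eqv f g -> eqv (S f) (S g);
  bop_linear : forall c f g, K c -> X f -> X g ->
    eqv (S (c *: f + g)) (c *: S f + S g);
  bop_bounded : exists C : R, forall f, X f -> nrm (S f) <= C * nrm f }.

Definition opnorm (S : F -> F) : R :=
  sup [set nrm (S f) | f in [set f | X f /\ nrm f <= 1]].

(* Only the times [t >= 0] matter. *)
Record C0_semigroup (T : R -> F -> F) : Prop := C0Semigroup {
  sg_bounded : forall t, 0 <= t -> bounded_operator (T t);
  sg_zero : forall f, X f -> eqv (T 0 f) f;
  sg_add : forall s t f, 0 <= s -> 0 <= t -> X f ->
    eqv (T (s + t) f) (T s (T t f));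
  sg_continuous : forall f, X f -> nrm (T t f - f) @[t --> 0^'+] --> (0 : R) }.

Definition contraction_semigroup (T : R -> F -> F) : Prop :=
  C0_semigroup T /\ forall t, 0 <= t -> opnorm (T t) <= 1.

(* Unbounded operators are given by their graphs. *)
Definition generator (T : R -> F -> F) (f g : F) : Prop :=
  [/\ X f, X g &
      nrm ((t^-1)%:C%C *: (T t f - f) - g) @[t --> 0^'+] --> (0 : R)].

Definition generates (A : F -> F -> Prop) (T : R -> F -> F) : Prop :=
  forall f g, generator T f g <-> A f g.

End Semigroup.

Section Matrices.
Context (R : realType).

Definition loewner_le n (A B : 'M[R]_n) : Prop :=
  forall v : 'cV[R]_n, (v^T *m A *m v) 0 0 <= (v^T *m B *m v) 0 0.

Definition adjmx m n (A : 'M[R[i]]_(m, n)) : 'M[R[i]]_(n, m) :=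
  (map_mx (@conjc R) A)^T.

Definition complex_mx m n (A : 'M[R]_(m, n)) : 'M[R[i]]_(m, n) :=
  map_mx (real_complex R) A.

Definition Sigma_mx n : 'M[R]_(n + n) := block_mx 0 1%:M 1%:M 0.

End Matrices.

Section PortHamiltonian.
Context (R : realType).
Variables (a b : R) (n : nat).
Local Notation mu := (@lebesgue_measure R).

Definition boundary_assumption (WB : 'M[R]_(n, n + n)) : Prop :=
  \rank WB = n /\ loewner_le 0 (WB *m Sigma_mx R n *m WB^T).

(* C^1 on the closed interval: the derivative on the open interval extends
   continuously to the endpoints. *)
Definition C1_mx (H : R -> 'M[R]_n) : Prop :=
  exists dH : R -> 'M[R]_n, forall i j,
    [/\ {within `[a, b], continuous (fun z => H z i j)},
        {within `[a, b], continuous (fun z => dH z i j)} &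
        forall z, z \in `]a, b[ -> is_derive z 1 (fun s => H s i j) (dH z i j)].

Definition hamiltonian_assumption (H : R -> 'M[R]_n) : Prop :=
  [/\ C1_mx H,
      forall z, z \in `[a, b] -> (H z)^T = H z &
      exists m M : R, [/\ 0 < m, 0 < M & forall z, z \in `[a, b] ->
        loewner_le m%:M (H z) /\ loewner_le (H z) M%:M]].

Definition structure_assumption (P1 P0 : 'M[R]_n) : Prop :=
  [/\ P1^T = P1, P1 \in unitmx & P0^T = - P0].

Definition cintegral (D : set R) (f : R -> R[i]) : R[i] :=
  ((\int[mu]_(z in D) complex.Re (f z)) +i*
   (\int[mu]_(z in D) complex.Im (f z)))%C.

Definition vintegral (D : set R) (f : R -> 'cV[R[i]]_n) : 'cV[R[i]]_n :=
  \col_i cintegral D (fun z => f z i 0).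

(* The functions on [R] that represent an element of L^2([a,b], K^n), where K is
   the real line or the whole of the complex numbers; their values outside of
   [a,b] are irrelevant. *)
Definition L2 (K : set R[i]) (f : R -> 'cV[R[i]]_n) : Prop :=
  forall i,
    [/\ forall z, z \in `[a, b] -> K (f z i 0),
        (fun z => complex.Re (f z i 0)) \_ `[a, b] \in Lfun mu 2%:E &
        (fun z => complex.Im (f z i 0)) \_ `[a, b] \in Lfun mu 2%:E].

Definition L2_eq (f g : R -> 'cV[R[i]]_n) : Prop :=
  f = g %[ae mu in `[a, b]%classic].

Definition inner (H : R -> 'M[R]_n) (f g : R -> 'cV[R[i]]_n) : R[i] :=
  2^-1 * cintegral `[a, b]
    (fun z => (adjmx (g z) *m complex_mx (H z) *m f z) 0 0).

Definition Xnorm (H : R -> 'M[R]_n) (f : R -> 'cV[R[i]]_n) : R :=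
  Num.sqrt (complex.Re (inner H f f)).

(* [y] is the absolutely continuous representative of an element of
   H^1([a,b], K^n), and [dy] represents its derivative. *)
Definition H1_deriv (K : set R[i]) (y dy : R -> 'cV[R[i]]_n) : Prop :=
  [/\ L2 K y, L2 K dy &
      forall z, z \in `[a, b] -> y z = y a + vintegral `[a, z] dy].

(* The column (e, f) of boundary effort and flow. *)
Definition boundary_port (P1 : 'M[R]_n) (y : R -> 'cV[R[i]]_n) :
    'cV[R[i]]_(n + n) :=
  ((Num.sqrt 2)^-1)%:C%C *:
    (complex_mx (block_mx 1%:M 1%:M P1 (- P1)) *m col_mx (y b) (y a)).

(* Graph of A: [x] is in D(A) and [z] = A [x]. The point evaluations are those of
   the absolutely continuous representative [y] of H x. *)
Definition port_hamiltonian (K : set R[i]) (P1 P0 : 'M[R]_n)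
    (H : R -> 'M[R]_n) (WB : 'M[R]_(n, n + n))
    (x z : R -> 'cV[R[i]]_n) : Prop :=
  [/\ L2 K x, L2 K z &
      exists y dy : R -> 'cV[R[i]]_n,
        [/\ H1_deriv K y dy,
            L2_eq y (fun s => complex_mx (H s) *m x s),
            complex_mx WB *m boundary_port P1 y = 0 &
            L2_eq z (fun s => complex_mx P1 *m dy s
                              + complex_mx P0 *m (complex_mx (H s) *m x s))]].

End PortHamiltonian.

Arguments L2 {R} a b {n} K f.
Arguments L2_eq {R} a b {n} f g.
Arguments Xnorm {R} a b {n} H f.

(* Main.v *)
Require Import Defs.
From mathcomp Require Import measurable_realfun ring lra.

(** Signals propagate at finite speed, and energy can only be lost through the two
ends of the interval. A state that vanishes near the ends therefore keeps its norm
until the ends are reached, and this time tau does not depend on the state but only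
on its distance to the boundary. As the T(t) are contractions, a single nonzero
state x0 with |T(t) x0| = |x0| for t <= tau gives the theorem.

Finite speed is proved by weights. Let d(z) = (z - a)(b - z), w = exp(- lam d) and
v = 1 - w, let N(x) = |x|^2 be the energy, and let V(x) be the energy with the
density multiplied by v. Since v vanishes at a and b, integration by parts
([Green_identity], [energy_generator]) gives, for x in the domain of A,
  2 Re <v A x, x> = - (1/2) int v' y^* P1 y   with y = H x,
with no boundary term. As |v'| <= lam (b - a) w and |y^* P1 y| <= C x^* H x, the
right side is at least - lam (b - a) C (N(x) - V(x)). Along x(t) = T(t) x0 the norm
does not increase, so u(t) = N(x0) - V(x(t)) satisfies u' <= lam (b - a) C u, and
[Gronwall] yields
  N(x(t)) >= V(x(t)) >= N(x0) - exp(lam (b - a) C t) (N(x0) - V(x0)).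
If x0 vanishes where d < delta, then N(x0) - V(x0) <= exp(- lam delta) N(x0)
([energy_wgt_le]). For t <= delta / (2 (b - a) C) the loss is thus at most
exp(- lam delta / 2) N(x0), for every lam, so there is none.

The energy lost at the ends never enters explicitly: the contractivity of the
semigroup says that it is nonnegative. The product rule behind the integration by
parts is needed for functions that are absolutely continuous only; it follows from
Fubini's theorem ([Rintegral_triangle], [has_densityM]). The differential inequality
is used in the form of a time step with a small error ([cwgt_energy_step]), because
the difference quotients of T(t) x0 converge uniformly in t ([generator_uniform]). *)

Set Implicit Arguments.
Unset Strict Implicit.
Unset Printing Implicit Defensive.

Import Order.TTheory GRing.Theory Num.Theory.
Import numFieldTopology.Exports numFieldNormedType.Exports.

Local Open Scope classical_set_scope.
Local Open Scope ring_scope.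

(** * Absolutely continuous functions *)

Section AC.
Context (R : realType).
Local Notation mu := (@lebesgue_measure R).
Local Notation TR := (g_sigma_algebraType (R.-ocitv.-measurable)).
Implicit Types (a b : R) (f g : R -> R).

Lemma integral_EFin_Rintegral (D : set R) f : measurable D ->
  mu.-integrable D (EFin \o f) ->
  (\int[mu]_(x in D) (f x)%:E = (\int[mu]_(x in D) f x)%:E)%E.
Proof. by move=> mD fi; rewrite /Rintegral fineK//; exact: integrable_fin_num. Qed.

Lemma integrable_patch (D : set R) f : measurable D ->
  mu.-integrable D (EFin \o f) <-> mu.-integrable setT (EFin \o (f \_ D)).
Proof. by move=> mD; rewrite -restrict_EFin; exact: integrable_mkcond. Qed.

Lemma patch_itvE (T : pointedType) (h : R -> T) a b (x : TR) :
  (h \_ `[a, b]) x = if a <= x <= b then h x else point.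
Proof.
rewrite patchE; congr (if _ then _ else _).
by apply/idP/idP => [/set_mem|xab]; [|apply/mem_set]; rewrite /= in_itv.
Qed.

(** Fubini on the triangle a <= y <= x <= b: both sides are the double integral of
f x * g y over it. This is what makes the product rule available for functions
that are merely integrals of integrable functions. *)
Lemma Rintegral_triangle a b f g :
  mu.-integrable `[a, b] (EFin \o f) -> mu.-integrable `[a, b] (EFin \o g) ->
  \int[mu]_(x in `[a, b]) (f x * \int[mu]_(y in `[a, x]) g y) =
  \int[mu]_(y in `[a, b]) (g y * \int[mu]_(x in `[y, b]) f x).
Proof.
move=> fi gi; set D := `[a, b]%classic.
have mD : measurable D by exact: measurable_itv.
pose k (p : TR * TR) : \bar R := ((f \_ D) p.1 * (g \_ D) p.2 * (p.2 <= p.1)%R%:R)%:E.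
have fD := (integrable_patch _ mD).1 fi.
have gD := (integrable_patch _ mD).1 gi.
have mf : measurable_fun setT (f \_ D).
  by apply/measurable_EFinP; exact: measurable_int fD.
have mg : measurable_fun setT (g \_ D).
  by apply/measurable_EFinP; exact: measurable_int gD.
have mle : measurable_fun setT (fun p : TR * TR => (p.2 <= p.1)%R%:R : R).
  have -> : (fun p : TR * TR => (p.2 <= p.1)%R%:R : R) =
            \1_[set p : TR * TR | p.2 <= p.1].
    apply/funext => p; rewrite indicE; congr (_%:R); congr nat_of_bool.
    by apply/idP/idP => [h|]; [exact/mem_set | move/set_mem].
  apply: measurable_indic; rewrite -[X in measurable X]setTI.
  exact: (measurable_fun_ler measurable_snd measurable_fst
           measurableT (Y := [set true])).
have mk : measurable_fun setT k.
  apply/measurable_EFinP; apply: measurable_funM => //.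
  apply: measurable_funM; first exact: measurableT_comp mf measurable_fst.
  exact: measurableT_comp mg measurable_snd.
(* |k (x, y)| is at most |f x| * |g y|, with f and g cut off outside [a, b]. *)
have ki : (mu \x mu)%E.-integrable setT k.
  apply: (integrable12ltyP _ _ mk).2.
  have ngD := integrable_norm gD; have nfD := integrable_norm fD.
  apply: (@le_lt_trans _ _
      (\int[mu]_x (`|(f \_ D) x| * \int[mu]_y `|(g \_ D) y|)%:E)%E).
    apply: ge0_le_integral => //.
    - by move=> x _; apply: integral_ge0.
    - apply: (measurable_fun_fubini_tonelli_F (abse \o k)) => //=.
      exact: measurableT_comp.
    - apply/measurable_EFinP; apply: measurable_funM => //.
      exact: measurableT_comp.
    move=> x _; rewrite EFinM -integral_EFin_Rintegral//.
    rewrite -ge0_integralZl//; last first.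
      by apply/measurable_EFinP; apply: measurableT_comp.
    apply: ge0_le_integral => //.
    - apply: measurableT_comp => //.
      exact: (measurableT_comp mk (measurable_pair1 x)).
    - apply: measurable_funeM; apply/measurable_EFinP; exact: measurableT_comp.
    move=> y _; rewrite /k /= lee_fin !normrM -[leRHS]mulr1.
    by rewrite ler_wpM2l ?mulr_ge0// normr_nat lern1 leq_b1.
  under eq_integral do rewrite mulrC EFinM.
  apply: integrable_lty => //; exact: integrableZl.
have E1 (x : R) : (\int[mu]_y k (x, y) =
    ((fun x => f x * \int[mu]_(y in `[a, x]) g y) \_ D x)%:E)%E.
  rewrite patch_itvE; case: ifPn => [|/negbTE] xD; last first.
    by apply: integral0_eq => y _; rewrite /k /= !patch_itvE xD !mul0r.
  have /andP[ax xb] := xD.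
  have gx : mu.-integrable `[a, x] (EFin \o g).
    by apply: integrableS gi => //; apply: subset_itvl; rewrite bnd_simp.
  rewrite EFinM -integral_EFin_Rintegral//.
  rewrite -integralZl// [RHS]integral_mkcond.
  apply: eq_integral => /= y _; rewrite /k /= !patch_itvE xD.
  case: (leP a y) => ay /=; last by rewrite mulr0 mul0r.
  case: (leP y x) => yx /=; last by rewrite mulr0.
  by rewrite (le_trans yx xb) mulr1.
have E2 (y : R) : (\int[mu]_x k (x, y) =
    ((fun y => g y * \int[mu]_(x in `[y, b]) f x) \_ D y)%:E)%E.
  rewrite patch_itvE; case: ifPn => [|/negbTE] yD; last first.
    by apply: integral0_eq => x _; rewrite /k /= !patch_itvE yD mulr0 !mul0r.
  have /andP[ay yb] := yD.
  have fy : mu.-integrable `[y, b] (EFin \o f).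
    by apply: integrableS fi => //; apply: subset_itvr; rewrite bnd_simp.
  rewrite EFinM -integral_EFin_Rintegral//.
  rewrite -integralZl// [RHS]integral_mkcond.
  apply: eq_integral => /= x _; rewrite /k /= !patch_itvE yD.
  case: (leP y x) => yx /=; last by rewrite mulr0.
  case: (leP x b) => xb /=; last by rewrite andbF !mul0r.
  by rewrite (le_trans ay yx) mulr1 mulrC.
have := Fubini ki.
under eq_integral do rewrite E1.
under [X in _ = X -> _]eq_integral do rewrite E2.
by move/(congr1 fine) => E; rewrite Rintegral_mkcond [RHS]Rintegral_mkcond.
Qed.


End AC.

Section AC2.
Context (R : realType).
Local Notation mu := (@lebesgue_measure R).
Implicit Types (a b : R) (f g : R -> R).

(** Absolute continuity on [a, b], with almost everywhere derivative f'. The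
elements of H^1 are given in this form, hence may fail to be differentiable at
some points. *)
Definition has_density a b f f' := mu.-integrable `[a, b] (EFin \o f') /\
  forall z, z \in `[a, b] -> f z = f a + \int[mu]_(s in `[a, z]) f' s.

Lemma has_density_continuous a b f f' : a <= b -> has_density a b f f' ->
  {within `[a, b], continuous f}.
Proof.
move=> ab [f'i fE].
have := parameterized_integral_continuous ab f'i => /= cI.
have : {within `[a, b], continuous (fun z => f a + \int[mu]_(s in `[a, z]) f' s)}.
  by move=> z; exact: (cvgD (cvg_cst _) (cI z)).
by apply: subspace_eq_continuous => z /set_mem zab /=; rewrite [RHS]fE.
Qed.

Lemma continuous_within_bounded a b f : {within `[a, b], continuous f} ->
  [bounded f x | x in `[a, b]].
Proof.
move=> cf; have := @continuous_compact _ _ _ _ cf (@segment_compact R a b).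
move/compact_bounded => [M [Mr h]]; exists M; split => // x Mx y yab.
by apply: (h x Mx); exists y.
Qed.

Lemma continuous_within_measurable a b f : {within `[a, b], continuous f} ->
  measurable_fun `[a, b] f.
Proof. by move=> cf; exact: subspace_continuous_measurable_fun. Qed.

Lemma continuousM_integrable a b f g : {within `[a, b], continuous f} ->
  mu.-integrable `[a, b] (EFin \o g) ->
  mu.-integrable `[a, b] (EFin \o (fun x => f x * g x)).
Proof.
move=> cf gi.
have := @integrableMr _ _ R mu _ (measurable_itv `[a, b]) f _
  (continuous_within_measurable cf) (continuous_within_bounded cf) gi.
by apply: eq_integrable => // x _; rewrite /= EFinM.
Qed.

Lemma integrable_cstM (D : set R) c f : measurable D ->
  mu.-integrable D (EFin \o f) -> mu.-integrable D (EFin \o (fun x => c * f x)).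
Proof.
move=> mD fi; have := @integrableZl _ _ R mu D mD c _ fi.
by apply: eq_integrable => // x _; rewrite /= EFinM.
Qed.

(** Once the values at a are split off, the rule says that the integrals F and G of
f' and g' satisfy F(z) G(z) = int (F g' + G f') on [a, z], and the triangle
a <= y <= x <= z together with its mirror image fills the square. *)
Lemma has_densityM a b f f' g g' : a <= b ->
  has_density a b f f' -> has_density a b g g' ->
  has_density a b (fun x => f x * g x) (fun x => f x * g' x + g x * f' x).
Proof.
move=> ab fd gd; have [[f'i fE] [g'i gE]] := (fd, gd).
have fg' := continuousM_integrable (has_density_continuous ab fd) g'i.
have gf' := continuousM_integrable (has_density_continuous ab gd) f'i.
split; first exact: integrableD fg' gf'.
move=> z zab; move: (zab); rewrite in_itv /= => /andP[az zb].
have sub : `[a, z] `<=` `[a, b] by apply: subset_itvl; rewrite bnd_simp.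
have rst (h : R -> R) : mu.-integrable `[a, b] (EFin \o h) ->
    mu.-integrable `[a, z] (EFin \o h) by apply: integrableS.
have f'z := rst _ f'i; have g'z := rst _ g'i.
rewrite RintegralD//; [|exact: rst|exact: rst].
pose F x := \int[mu]_(s in `[a, x]) f' s.
pose G x := \int[mu]_(s in `[a, x]) g' s.
have cF : {within `[a, z], continuous F} by exact: parameterized_integral_continuous.
have cG : {within `[a, z], continuous G} by exact: parameterized_integral_continuous.
have Gf'i := continuousM_integrable cG f'z.
have Fg'i := continuousM_integrable cF g'z.
have inz x : x \in `[a, z] -> x \in `[a, b] by exact: sub.
have -> : \int[mu]_(x in `[a, z]) (f x * g' x) =
    f a * G z + \int[mu]_(x in `[a, z]) (F x * g' x).
  rewrite -RintegralZl// -RintegralD//; last exact: integrable_cstM.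
  by apply: eq_Rintegral => x xz; rewrite fE ?mulrDl//; apply: inz; rewrite inE in xz.
have -> : \int[mu]_(x in `[a, z]) (g x * f' x) =
    g a * F z + \int[mu]_(x in `[a, z]) (G x * f' x).
  rewrite -RintegralZl// -RintegralD//; last exact: integrable_cstM.
  by apply: eq_Rintegral => x xz; rewrite gE ?mulrDl//; apply: inz; rewrite inE in xz.
have -> : \int[mu]_(x in `[a, z]) (F x * g' x) =
    F z * G z - \int[mu]_(x in `[a, z]) (G x * f' x).
  rewrite [F z * _]mulrC -RintegralZl// -[in RHS]RintegralB//; last exact: integrable_cstM.
  transitivity (\int[mu]_(x in `[a, z]) (g' x * \int[mu]_(y in `[a, x]) f' y)).
    by apply: eq_Rintegral => x _; rewrite mulrC.
  rewrite Rintegral_triangle//; apply: eq_Rintegral => y.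
  rewrite inE /= in_itv /= => /andP[ay yz].
  rewrite -mulrBl mulrC /G Rintegral_itvB ?bnd_simp// Rintegral_itv_obnd_cbnd//.
  apply: integrableS g'z => //; apply: subset_itvr; by rewrite bnd_simp.
rewrite fE// gE// -/(F z) -/(G z); ring.
Qed.

End AC2.

(** * Square-integrable functions *)

Section L2facts.
Context (R : realType).
Local Notation mu := (@lebesgue_measure R).
Implicit Types (a b c : R) (f g : R -> R).

Lemma has_density_C1 a b f f' : a < b ->
  {within `[a, b], continuous f} -> {within `[a, b], continuous f'} ->
  (forall z, z \in `]a, b[ -> is_derive z 1 f (f' z)) ->
  has_density a b f f'.
Proof.
move=> ab cf cf' df; split.
  by apply: continuous_compact_integrable => //; exact: segment_compact.
move=> z; rewrite in_itv /= => /andP[]; rewrite le_eqVlt => /predU1P[<- _|az zb].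
  by rewrite set_itv1 Rintegral_set1 addr0.
have sub : `[a, z] `<=` `[a, b] by apply: subset_itvl; rewrite bnd_simp.
have cfz := continuous_subspaceW sub cf; have cfz' := continuous_subspaceW sub cf'.
have inz x : x \in `]a, z[ -> x \in `]a, b[.
  by rewrite !in_itv /= => /andP[-> /= /lt_le_trans]; exact.
have dz : derivable_oo_LRcontinuous f a z.
  have /(continuous_within_itvP _ az)[_ ? ?] := cfz; split => //.
  by move=> x /inz /df [].
have F'E : {in `]a, z[, derive1 f =1 f'}.
  by move=> x /inz xab; have := df _ xab; rewrite derive1E => ?; exact: derive_val.
by rewrite /Rintegral (continuous_FTC2 az cfz' dz F'E) /= addrCA subrr addr0.
Qed.

Definition square_integrable a b f := measurable_fun `[a, b] f /\
  mu.-integrable `[a, b] (EFin \o (fun x => f x ^+ 2)).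

(** All later closure properties of L^2 reduce to integrability of products through
this description. *)
Lemma Lfun2_patchP a b f :
  f \_ `[a, b] \in Lfun mu 2%:E <-> square_integrable a b f.
Proof.
have sqE : (fun x => (f \_ `[a, b]) x ^+ 2) = (fun x => f x ^+ 2) \_ `[a, b].
  by apply/funext => x; rewrite !patchE; case: ifP => // _; rewrite expr0n.
split=> [/[dup] /Lfun2_integrable_sqr|[mf fi]].
  rewrite sqE => /(integrable_patch _ (measurable_itv _)).2 h.
  rewrite inE => /andP[]; rewrite inE /= => mf _; split => //.
  exact: (measurable_restrictT f (measurable_itv `[a, b])).2.
rewrite inE; apply/andP; split; rewrite inE /=.
  exact: (measurable_restrictT f (measurable_itv `[a, b])).1.
rewrite /finite_norm unlock /Lnorm /= poweR_lty//.
have := (integrable_patch _ (measurable_itv _)).1 fi.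
rewrite -sqE => /integrable_lty h; apply: le_lt_trans (h _) => //.
rewrite le_eqVlt; apply/orP; left; apply/eqP; apply: eq_integral => x _.
by rewrite /= powR_mulrn// -normrX ger0_norm ?sqr_ge0.
Qed.


(** |f g| <= f^2 + g^2. *)
Lemma square_integrableM_integrable a b f g :
  square_integrable a b f -> square_integrable a b g ->
  mu.-integrable `[a, b] (EFin \o (fun x => f x * g x)).
Proof.
move=> [mf fi] [mg gi].
have h := @integrableD _ _ R mu _ (measurable_itv `[a, b]) _ _ fi gi.
apply: le_integrable h => //.
  by apply/measurable_EFinP; exact: measurable_funM.
move=> x _; rewrite /= lee_fin normrM [leRHS]ger0_norm ?addr_ge0 ?sqr_ge0//.
rewrite -(real_normK (num_real (f x))) -(real_normK (num_real (g x))).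
have := sqr_ge0 (`|f x| - `|g x|); have := normr_ge0 (f x); have := normr_ge0 (g x).
nra.
Qed.

Lemma square_integrable_lin a b c f g :
  square_integrable a b f -> square_integrable a b g ->
  square_integrable a b (fun x => c * f x + g x).
Proof.
move=> fs gs; have fgi := square_integrableM_integrable fs gs.
have [[mf fi] [mg gi]] := (fs, gs).
split.
  by apply: measurable_funD => //; exact: measurable_funM.
have := integrable_cstM (c ^+ 2) (measurable_itv `[a, b]) fi.
have := integrable_cstM (c * 2) (measurable_itv `[a, b]) fgi.
move=> i1 i2.
have := @integrableD _ _ R mu _ (measurable_itv `[a, b]) _ _
  (@integrableD _ _ R mu _ (measurable_itv `[a, b]) _ _ i2 i1) gi.
apply: eq_integrable => // x _; rewrite /= -!EFinD; congr EFin; ring.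
Qed.

Lemma continuous_square_integrable a b f : {within `[a, b], continuous f} ->
  square_integrable a b f.
Proof.
move=> cf; split; first exact: continuous_within_measurable.
have fi : mu.-integrable `[a, b] (EFin \o f).
  by apply: continuous_compact_integrable => //; exact: segment_compact.
by have := continuousM_integrable cf fi.
Qed.

Lemma square_integrable_integrable a b f : square_integrable a b f ->
  mu.-integrable `[a, b] (EFin \o f).
Proof.
move=> fs; have c1 : square_integrable a b (cst 1).
  by apply: continuous_square_integrable => z; exact: cst_continuous.
have := square_integrableM_integrable c1 fs.
by apply: eq_integrable => // x _; rewrite /= mul1r.
Qed.

End L2facts.

(** * Real parts of Hermitian forms with real matrices *)

Section Algebra.
Context (R : realType) (n : nat).
Implicit Types (A B : 'M[R]_n) (u v w : 'cV[R[i]]_n).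

Definition reV u : 'cV[R]_n := map_mx (@complex.Re R) u.
Definition imV u : 'cV[R]_n := map_mx (@complex.Im R) u.

Definition bilin A (p q : 'cV[R]_n) : R := (p^T *m A *m q) 0 0.

(** The real part of u^* A v, for a real matrix A. *)
Definition cdot A u v : R := bilin A (reV u) (reV v) + bilin A (imV u) (imV v).

Lemma bilinE A p q : bilin A p q = \sum_j \sum_i A i j * (p i 0 * q j 0).
Proof.
rewrite /bilin mxE; apply: eq_bigr => j _; rewrite mxE big_distrl /=.
by apply: eq_bigr => i _; rewrite !mxE; ring.
Qed.

Lemma cdotE A u v : cdot A u v = \sum_j \sum_i A i j *
  (complex.Re (u i 0) * complex.Re (v j 0) + complex.Im (u i 0) * complex.Im (v j 0)).
Proof.
rewrite /cdot !bilinE -big_split; apply: eq_bigr => j _ /=.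
by rewrite -big_split; apply: eq_bigr => i _ /=; rewrite !mxE mulrDr.
Qed.

Lemma Re_adjmxM A u v : complex.Re ((adjmx u *m complex_mx A *m v) 0 0) = cdot A u v.
Proof.
rewrite cdotE mxE raddf_sum; apply: eq_bigr => j _.
rewrite mxE big_distrl raddf_sum; apply: eq_bigr => i _.
rewrite !mxE; case: (u i 0) => x1 y1; case: (v j 0) => x2 y2 /=; ring.
Qed.

Lemma bilinDl A c p q r : bilin A (c *: p + q) r = c * bilin A p r + bilin A q r.
Proof. by rewrite /bilin linearD /= linearZ /= !mulmxDl -!scalemxAl !mxE. Qed.

Lemma bilinC A p q : A^T = A -> bilin A p q = bilin A q p.
Proof.
move=> sA; rewrite /bilin; transitivity ((p^T *m A *m q)^T 0 0); first by rewrite [RHS]mxE.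
by rewrite !trmx_mul trmxK sA mulmxA.
Qed.

Lemma bilinMr A B p q : bilin A p (B *m q) = bilin (A *m B) p q.
Proof. by rewrite /bilin !mulmxA. Qed.

Lemma bilinMl A B p q : bilin A (B *m p) q = bilin (B^T *m A) p q.
Proof. by rewrite /bilin trmx_mul !mulmxA. Qed.

Lemma bilin_skew A p : A^T = - A -> bilin A p p = 0.
Proof.
move=> sA; have : bilin A p p = - bilin A p p.
  rewrite {1}/bilin; transitivity ((p^T *m A *m p)^T 0 0); first by rewrite [RHS]mxE.
  by rewrite !trmx_mul trmxK sA mulNmx mulmxN mxE mulmxA.
by move/eqP; rewrite -subr_eq0 opprK -mulr2n mulrn_eq0 => /eqP.
Qed.

Lemma reV_lin c u v : reV (c%:C%C *: u + v) = c *: reV u + reV v.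
Proof.
apply/colP => i; rewrite !mxE.
by case: (u i 0) => ? ?; case: (v i 0) => ? ? /=; rewrite mul0r subr0.
Qed.

Lemma imV_lin c u v : imV (c%:C%C *: u + v) = c *: imV u + imV v.
Proof.
apply/colP => i; rewrite !mxE.
by case: (u i 0) => ? ?; case: (v i 0) => ? ? /=; rewrite mul0r addr0.
Qed.

Lemma reV_complexM A u : reV (complex_mx A *m u) = A *m reV u.
Proof.
apply/colP => i; rewrite !mxE raddf_sum; apply: eq_bigr => j _.
by rewrite !mxE; case: (u j 0) => ? ? /=; rewrite mul0r subr0.
Qed.

Lemma imV_complexM A u : imV (complex_mx A *m u) = A *m imV u.
Proof.
apply/colP => i; rewrite !mxE raddf_sum; apply: eq_bigr => j _.
by rewrite !mxE; case: (u j 0) => ? ? /=; rewrite mul0r addr0.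
Qed.

Lemma cdot_linl A c u v w :
  cdot A (c%:C%C *: u + v) w = c * cdot A u w + cdot A v w.
Proof. by rewrite /cdot reV_lin imV_lin !bilinDl; ring. Qed.

Lemma cdotC A u v : A^T = A -> cdot A u v = cdot A v u.
Proof. by move=> sA; rewrite /cdot bilinC// [bilin _ (imV u) _]bilinC. Qed.

Lemma cdotMr A B u v : cdot A u (complex_mx B *m v) = cdot (A *m B) u v.
Proof. by rewrite /cdot reV_complexM imV_complexM !bilinMr. Qed.

Lemma cdotMl A B u v : cdot A (complex_mx B *m u) v = cdot (B^T *m A) u v.
Proof. by rewrite /cdot reV_complexM imV_complexM !bilinMl. Qed.

Lemma cdot_skew A u : A^T = - A -> cdot A u u = 0.
Proof. by move=> sA; rewrite /cdot !bilin_skew// addr0. Qed.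

Lemma cdotZ A c u :
  cdot A (c%:C%C *: u) (c%:C%C *: u) = c ^+ 2 * cdot A u u.
Proof.
rewrite !cdotE mulr_sumr; apply: eq_bigr => j _; rewrite mulr_sumr; apply: eq_bigr => i _.
by rewrite !mxE; case: (u i 0) => ? ?; case: (u j 0) => ? ? /=; ring.
Qed.

Definition sqnorm u : R :=
  \sum_i (complex.Re (u i 0) ^+ 2 + complex.Im (u i 0) ^+ 2).

Lemma loewner_cdot m A u : loewner_le m%:M A -> m * sqnorm u <= cdot A u u.
Proof.
move=> mA; have E p : (p^T *m (m%:M : 'M[R]_n) *m p) 0 0 = m * \sum_i p i 0 ^+ 2.
  rewrite mul_mx_scalar -scalemxAl mxE mxE; congr (_ * _).
  by apply: eq_bigr => i _; rewrite mxE.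
have := lerD (mA (reV u)) (mA (imV u)); rewrite !E -mulrDr -big_split /=.
by rewrite /sqnorm; under eq_bigr do rewrite !mxE.
Qed.

Lemma sqnorm_ge0 u : 0 <= sqnorm u.
Proof. by apply: sumr_ge0 => i _; rewrite addr_ge0 ?sqr_ge0. Qed.

(** Bounding each product of entries by a mean of squares costs a factor n. *)
Lemma cdot_bound A u C : (forall i j, `|A i j| <= C) ->
  `|cdot A u u| <= n%:R * C * sqnorm u.
Proof.
move=> AC; rewrite cdotE; apply: le_trans (ler_norm_sum _ _ _) _.
pose s i := complex.Re (u i 0) ^+ 2 + complex.Im (u i 0) ^+ 2.
have H1 j : `|\sum_i A i j * (complex.Re (u i 0) * complex.Re (u j 0) +
    complex.Im (u i 0) * complex.Im (u j 0))| <= \sum_i C * (2^-1 * (s i + s j)).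
  apply: le_trans (ler_norm_sum _ _ _) _; apply: ler_sum => i _.
  rewrite normrM ler_pM//; rewrite /s ler_norml.
  move: (complex.Re _) (complex.Re _) (complex.Im _) (complex.Im _) => x y z t.
  have := sqr_ge0 (x - y); have := sqr_ge0 (x + y).
  have := sqr_ge0 (z - t); have := sqr_ge0 (z + t).
  by move=> *; apply/andP; split; nra.
apply: le_trans (ler_sum _ (fun j _ => H1 j)) _.
under eq_bigr do rewrite -mulr_sumr -mulr_sumr big_split /= sumr_const card_ord.
rewrite -mulr_sumr -mulr_sumr big_split /= sumr_const card_ord sumrMnl -/(sqnorm u).
rewrite -mulr2n -!mulrnA -[_ *+ (n * 2)]mulr_natr natrM.
by rewrite le_eqVlt; apply/orP; left; apply/eqP; field.
Qed.

End Algebra.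

(** * Weighted energies *)

Section Energy.
Context (R : realType) (n : nat).
Local Notation mu := (@lebesgue_measure R).
Variables (a b : R).
Implicit Types (v : R -> R) (f g h : R -> 'cV[R[i]]_n) (A : R -> 'M[R]_n).

Definition L2vec f := forall i,
  square_integrable a b (fun z => complex.Re (f z i 0)) /\
  square_integrable a b (fun z => complex.Im (f z i 0)).

Lemma L2_L2vec K f : L2 a b K f -> L2vec f.
Proof. by move=> fK i; have [_ /Lfun2_patchP ? /Lfun2_patchP ?] := fK i. Qed.

Definition continuous_mx m p (A : R -> 'M[R]_(m, p)) :=
  forall i j, {within `[a, b], continuous (fun z => A z i j)}.

Lemma continuous_mx_cst m p (B : 'M[R]_(m, p)) : continuous_mx (fun=> B).
Proof. by move=> i j z; exact: cst_continuous. Qed.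

Lemma cdot_integrable v A f g : {within `[a, b], continuous v} -> continuous_mx A ->
  L2vec f -> L2vec g ->
  mu.-integrable `[a, b] (EFin \o (fun z => v z * cdot (A z) (f z) (g z))).
Proof.
move=> cv cA f2 g2; apply: continuousM_integrable => //.
have : mu.-integrable `[a, b] (fun z => \sum_j \sum_i (A z i j *
  (complex.Re (f z i 0) * complex.Re (g z j 0) +
   complex.Im (f z i 0) * complex.Im (g z j 0)))%:E)%E.
  apply: integrable_sum => // j _; apply: integrable_sum => // i _.
  apply: (continuousM_integrable (cA i j)).
  have [fr fi] := f2 i; have [gr gi] := g2 j.
  have := @integrableD _ _ R mu _ (measurable_itv `[a, b]) _ _
    (square_integrableM_integrable fr gr) (square_integrableM_integrable fi gi).
  by apply: eq_integrable => // x _; rewrite /= EFinD.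
apply: eq_integrable => // x _; rewrite /= cdotE -sumEFin.
by apply: eq_bigr => j _; rewrite -sumEFin.
Qed.

(** The weight v = 1 and the matrix A = H give the inner product of the state
space (its real part); weights that vanish at a and b ignore what crosses the
boundary. *)
Definition energy v A f g : R :=
  2^-1 * \int[mu]_(z in `[a, b]) (v z * cdot (A z) (f z) (g z)).

Lemma energy_linl v A c f g h : {within `[a, b], continuous v} -> continuous_mx A ->
  L2vec f -> L2vec g -> L2vec h ->
  energy v A (c%:C%C *: f + g) h = c * energy v A f h + energy v A g h.
Proof.
move=> cv cA f2 g2 h2; rewrite /energy mulrCA -mulrDr; congr (_ * _).
have ifh := cdot_integrable cv cA f2 h2; have igh := cdot_integrable cv cA g2 h2.
rewrite -RintegralZl// -RintegralD//; last exact: integrable_cstM.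
by apply: eq_Rintegral => z _; rewrite cdot_linl; ring.
Qed.

Lemma energyC v A f g : (forall z, z \in `[a, b] -> (A z)^T = A z) ->
  energy v A f g = energy v A g f.
Proof.
move=> sA; congr (_ * _); apply: eq_Rintegral => z /set_mem zab.
by rewrite cdotC// sA.
Qed.

Lemma L2vec_lin c f g : L2vec f -> L2vec g -> L2vec (c%:C%C *: f + g).
Proof.
move=> f2 g2 i; have [fr fi] := f2 i; have [gr gi] := g2 i; split.
  have := square_integrable_lin c fr gr; congr square_integrable.
  apply/funext => z; rewrite !mxE; case: (f z i 0) => ? ?; case: (g z i 0) => ? ? /=.
  by rewrite mul0r subr0.
have := square_integrable_lin c fi gi; congr square_integrable.
apply/funext => z; rewrite !mxE; case: (f z i 0) => ? ?; case: (g z i 0) => ? ? /=.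
by rewrite mul0r addr0.
Qed.

Lemma energy_expand v A c f g : {within `[a, b], continuous v} -> continuous_mx A ->
  (forall z, z \in `[a, b] -> (A z)^T = A z) -> L2vec f -> L2vec g ->
  energy v A (c%:C%C *: f + g) (c%:C%C *: f + g) =
  c ^+ 2 * energy v A f f + 2 * c * energy v A f g + energy v A g g.
Proof.
move=> cv cA sA f2 g2; have fg2 := L2vec_lin c f2 g2.
rewrite energy_linl// [energy v A f (_ + _)]energyC//.
rewrite [energy v A g (_ + _)]energyC// !energy_linl// [energy v A g f]energyC//; ring.
Qed.

Lemma le_energy v w A f : {within `[a, b], continuous v} ->
  {within `[a, b], continuous w} -> continuous_mx A -> L2vec f ->
  (forall z, z \in `[a, b] -> v z <= w z) ->
  (forall z u, z \in `[a, b] -> 0 <= cdot (A z) u u) ->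
  energy v A f f <= energy w A f f.
Proof.
move=> cv cw cA f2 vw A0; rewrite ler_pM2l ?invr_gt0//.
apply: le_Rintegral => //; [exact: cdot_integrable|exact: cdot_integrable|].
by move=> z zab; rewrite ler_wpM2r ?A0 ?vw.
Qed.

Lemma energy_ge0 v A f : (forall z, z \in `[a, b] -> 0 <= v z) ->
  (forall z u, z \in `[a, b] -> 0 <= cdot (A z) u u) -> 0 <= energy v A f f.
Proof.
move=> v0 A0; rewrite mulr_ge0// Rintegral_ge0// => z zab.
by rewrite mulr_ge0 ?v0 ?A0.
Qed.

Lemma energy_ae v A f g : {within `[a, b], continuous v} -> continuous_mx A ->
  L2vec f -> L2vec g -> L2_eq a b f g ->
  energy v A f f = energy v A g g.
Proof.
move=> cv cA f2 g2 fg; congr (_ * _); rewrite /Rintegral; congr fine.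
apply: ae_eq_integral => //.
- exact: measurable_int (cdot_integrable cv cA f2 f2).
- exact: measurable_int (cdot_integrable cv cA g2 g2).
have [N [mN N0 fgN]] := fg; exists N; split => // z /= neq.
by apply: fgN => /= fgz; apply: neq => zab; rewrite fgz.
Qed.

Lemma XnormE A f : Xnorm a b A f = Num.sqrt (energy (cst 1) A f f).
Proof.
rewrite /Xnorm; congr Num.sqrt; rewrite /inner /cintegral /energy.
have -> : (2^-1 : R[i]) = (2^-1)%:C%C by rewrite fmorphV rmorph_nat.
rewrite /= mul0r subr0; congr (_ * _); apply: eq_Rintegral => z _.
by rewrite Re_adjmxM mul1r.
Qed.

End Energy.

(** * Integration by parts for the port-Hamiltonian operator *)

Section Green.
Context (R : realType) (n : nat).
Local Notation mu := (@lebesgue_measure R).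
Variables (a b : R).
Hypothesis ab : a < b.
Implicit Types (v : R -> R) (f g h : R -> 'cV[R[i]]_n) (A : R -> 'M[R]_n).

Lemma has_density_lin c (f f' g g' : R -> R) : has_density a b f f' -> has_density a b g g' ->
  has_density a b (fun x => c * f x + g x) (fun x => c * f' x + g' x).
Proof.
move=> [f'i fE] [g'i gE]; split.
  have := @integrableD _ _ R mu _ (measurable_itv `[a, b]) _ _
    (integrable_cstM c (measurable_itv `[a, b]) f'i) g'i.
  by apply: eq_integrable => // x _; rewrite /= EFinD.
move=> z zab; have sub : `[a, z] `<=` `[a, b].
  by apply: subset_itvl; rewrite bnd_simp; move: zab; rewrite in_itv => /andP[].
have rst (h : R -> R) : mu.-integrable `[a, b] (EFin \o h) ->
    mu.-integrable `[a, z] (EFin \o h) by apply: integrableS.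
rewrite RintegralD//; [|exact/integrable_cstM/rst|exact: rst].
rewrite RintegralZl//; last exact: rst.
rewrite fE// gE//; ring.
Qed.

Lemma has_density_cst c : has_density a b (cst c) (cst 0).
Proof.
split; first exact: integrable0.
by move=> z _; rewrite /= /Rintegral integral0 addr0.
Qed.

Lemma has_density_sum (I : Type) (r : seq I) (F F' : I -> R -> R) :
  (forall i, has_density a b (F i) (F' i)) ->
  has_density a b (fun x => \sum_(i <- r) F i x) (fun x => \sum_(i <- r) F' i x).
Proof.
move=> FF'; elim: r => [|i r IH].
  have := has_density_cst 0; congr has_density; apply/funext => x /=; by rewrite big_nil.
have := has_density_lin 1 (FF' i) IH; congr has_density; apply/funext => x /=;
  by rewrite big_cons mul1r.
Qed.

Lemma H1_density K f g : H1_deriv a b K f g -> forall i,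
  has_density a b (fun z => complex.Re (f z i 0)) (fun z => complex.Re (g z i 0)) /\
  has_density a b (fun z => complex.Im (f z i 0)) (fun z => complex.Im (g z i 0)).
Proof.
move=> [f2 g2 fE] i; have [gr gi] := L2_L2vec g2 i.
split; split; try exact: square_integrable_integrable.
  move=> z zab; rewrite [in LHS]fE// !mxE; case: (f a i 0) => ? ? //=.
move=> z zab; rewrite [in LHS]fE// !mxE; case: (f a i 0) => ? ? //=.
Qed.

Lemma has_density_cdot (P : 'M[R]_n) K f g : P^T = P -> H1_deriv a b K f g ->
  has_density a b (fun z => cdot P (f z) (f z)) (fun z => 2 * cdot P (f z) (g z)).
Proof.
move=> sP fg.
have H j i : has_density a b
    (fun z => P i j * (complex.Re (f z i 0) * complex.Re (f z j 0) +
                       complex.Im (f z i 0) * complex.Im (f z j 0)))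
    (fun z => P i j * (complex.Re (f z i 0) * complex.Re (g z j 0) +
                       complex.Im (f z i 0) * complex.Im (g z j 0)) +
              P i j * (complex.Re (g z i 0) * complex.Re (f z j 0) +
                       complex.Im (g z i 0) * complex.Im (f z j 0))).
  have [ri ii] := H1_density fg i; have [rj ij] := H1_density fg j.
  have := has_density_lin (P i j) (has_densityM (ltW ab) ri rj)
    (has_density_lin (P i j) (has_densityM (ltW ab) ii ij) (has_density_cst 0)).
  by congr has_density; apply/funext => x /=; ring.
have := has_density_sum (index_enum 'I_n) (fun j => has_density_sum (index_enum 'I_n) (H j)).
congr has_density; apply/funext => z; first by rewrite cdotE.
rewrite mulrDl mul1r {2}cdotC// !cdotE -big_split; apply: eq_bigr => j _ /=.
by rewrite -big_split.
Qed.

(** The boundary values of f are not constrained: it is the weight v that vanishes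
at both ends. *)
Lemma Green_identity (P : 'M[R]_n) K v v' f g : P^T = P -> H1_deriv a b K f g ->
  has_density a b v v' -> {within `[a, b], continuous v'} -> v a = 0 -> v b = 0 ->
  \int[mu]_(z in `[a, b]) (v z * (2 * cdot P (f z) (g z))) =
  - \int[mu]_(z in `[a, b]) (v' z * cdot P (f z) (f z)).
Proof.
move=> sP fg vv' cv' va vb; have fd := has_density_cdot sP fg.
have [_] := has_densityM (ltW ab) vv' fd.
move=> /(_ b); rewrite in_itv /= lexx (ltW ab) va vb !mul0r add0r => /(_ isT).
have cv := has_density_continuous (ltW ab) vv'.
rewrite RintegralD//; last 2 first.
- by apply: continuousM_integrable cv _; case: fd.
- apply: continuousM_integrable; last by case: vv'.
  exact: has_density_continuous (ltW ab) fd.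
move/esym/eqP; rewrite addr_eq0 => /eqP ->; congr (- _).
by apply: eq_Rintegral => z _; rewrite mulrC.
Qed.

(** Write y for the product of A and f. The skew part P0 contributes nothing to
Re (y^* g), and the rest is Re (y^* P1 y'), half of the derivative of
y^* P1 y. What remains involves no derivative of f. *)
Lemma energy_generator K P1 P0 (WB : 'M[R]_(n, n + n)) A v v' f g :
  P1^T = P1 -> P0^T = - P0 -> continuous_mx a b A ->
  (forall z, z \in `[a, b] -> (A z)^T = A z) ->
  has_density a b v v' -> {within `[a, b], continuous v'} -> v a = 0 -> v b = 0 ->
  continuous_mx a b (fun z => A z *m P1 *m A z) ->
  port_hamiltonian a b K P1 P0 A WB f g ->
  2 * energy a b v A f g = - energy a b v' (fun z => A z *m P1 *m A z) f f.
Proof.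
move=> sP1 sP0 cA sA vv' cv' va vb cAPA [fK gK [y [dy [ydy yE _ gE]]]].
have cv := has_density_continuous (ltW ab) vv'.
have f2 := L2_L2vec fK; have g2 := L2_L2vec gK.
have [y2 dy2] : L2vec a b y /\ L2vec a b dy by case: ydy => /L2_L2vec ? /L2_L2vec.
have cP1 := @continuous_mx_cst R a b n n P1.
rewrite /energy mulrCA -mulrN; congr (_ * _).
have -> : \int[mu]_(z in `[a, b]) (v z * cdot (A z) (f z) (g z)) =
          \int[mu]_(z in `[a, b]) (v z * cdot P1 (y z) (dy z)).
  rewrite /Rintegral; congr fine; apply: ae_eq_integral => //.
  - exact: measurable_int (cdot_integrable cv cA f2 g2).
  - exact: measurable_int (cdot_integrable cv cP1 y2 dy2).
  have [N1 [mN1 N10 yN]] := yE; have [N2 [mN2 N20 gN]] := gE.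
  exists (N1 `|` N2); split; [exact: measurableU|exact: null_set_setU|].
  move=> z /= neq; apply: contrapT => /not_orP[z1 z2]; apply: neq => zab.
  have yz : y z = complex_mx (A z) *m f z.
    by apply: contrapT => ne; apply: z1; apply: yN => /= /(_ zab).
  have gz : g z = complex_mx P1 *m dy z + complex_mx P0 *m (complex_mx (A z) *m f z).
    by apply: contrapT => ne; apply: z2; apply: gN => /= /(_ zab).
  congr (_ * _)%:E; rewrite gz -yz.
  rewrite cdotC ?sA// -[complex_mx P1 *m _]scale1r cdot_linl mul1r !cdotMl sP1 sP0.
  rewrite -!cdotMr -yz (cdotC _ _ sP1) cdot_skew ?addr0//.
  by rewrite linearN /= sP0 opprK.
have -> : \int[mu]_(z in `[a, b]) (v' z * cdot (A z *m P1 *m A z) (f z) (f z)) =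
          \int[mu]_(z in `[a, b]) (v' z * cdot P1 (y z) (y z)).
  rewrite /Rintegral; congr fine; apply: ae_eq_integral => //.
  - exact: measurable_int (cdot_integrable cv' cAPA f2 f2).
  - exact: measurable_int (cdot_integrable cv' cP1 y2 y2).
  have [N [mN N0 yN]] := yE.
  exists N; split => // z /= neq; apply: yN => /= yz; apply: neq => zab.
  by congr (_ * _)%:E; rewrite yz// cdotMr cdotMl sA// mulmxA.
rewrite -(Green_identity sP1 ydy vv')// -RintegralZl//; last exact: cdot_integrable.
by apply: eq_Rintegral => z _; ring.
Qed.

End Green.

(** * Exponential weights *)

Section Weight.
Context (R : realType).
Local Notation mu := (@lebesgue_measure R).
Variables (a b : R).
Hypothesis ab : a < b.

Lemma continuous_mxM m n p (A : R -> 'M[R]_(m, n)) (B : R -> 'M[R]_(n, p)) :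
  continuous_mx a b A -> continuous_mx a b B ->
  continuous_mx a b (fun z => A z *m B z).
Proof.
move=> cA cB i j.
have -> : (fun z => (A z *m B z) i j) = (fun z => \sum_k A z i k * B z k j).
  by apply/funext => z; rewrite mxE.
elim: (index_enum _) => [|k r IH].
  rewrite (_ : (fun=> _) = cst 0); last by apply/funext => z; rewrite big_nil.
  by move=> z; exact: cst_continuous.
rewrite (_ : (fun=> _) = fun z => A z i k * B z k j + \sum_(l <- r) A z i l * B z l j).
  by move=> z; exact: (cvgD (cvgM (cA i k z) (cB k j z)) (IH z)).
by apply/funext => z; rewrite big_cons.
Qed.

Lemma continuous_mx_bounded n (A : R -> 'M[R]_n) : continuous_mx a b A ->
  exists C, forall i j z, z \in `[a, b] -> `|A z i j| <= C.
Proof.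
move=> cA.
have /choice[C HC] : forall ij : 'I_n * 'I_n, exists C,
    forall z, z \in `[a, b] -> `|A z ij.1 ij.2| <= C.
  move=> [i j]; have [M [_ HM]] := continuous_within_bounded (cA i j).
  by exists (M + 1) => z zab; apply: HM => //; rewrite ltrDl.
exists (\sum_ij `|C ij|) => i j z zab; apply: le_trans (HC (i, j) z zab) _.
rewrite (bigD1 (i, j)) //= (le_trans (ler_norm _))// lerDl.
by apply: sumr_ge0.
Qed.

(** A smooth substitute for the distance to the boundary: it vanishes at a and b, is
positive between them, and its slope is at most b - a. *)
Definition bdist (z : R) := (z - a) * (b - z).

Lemma is_derive_bdist (z : R) : is_derive z 1 bdist (a + b - 2 * z).
Proof.
rewrite /bdist; apply: is_derive_eq; rewrite /GRing.scale /=; ring.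
Qed.

Lemma bdist_ge0 z : z \in `[a, b] -> 0 <= bdist z.
Proof. by rewrite in_itv /= => /andP[? ?]; rewrite mulr_ge0// subr_ge0. Qed.

Variable lam : R.
Hypothesis lam0 : 0 <= lam.

(** wgt is 1 at the boundary and decays at rate lam inside, so that its energy
measures how much of a state is close to the boundary. The point of the
exponential is that the derivative is bounded by lam times the weight itself. *)
Definition wgt z := expR (- lam * bdist z).
Definition cwgt z := 1 - wgt z.
Definition dcwgt z := lam * (a + b - 2 * z) * wgt z.

Lemma is_derive_cwgt (z : R) : is_derive z 1 cwgt (dcwgt z).
Proof.
have H1 := is_derive_bdist z.
rewrite /cwgt /wgt /dcwgt. 
apply: is_derive_eq; rewrite /GRing.scale /= /wgt; ring.
Qed.

Lemma continuous_wgt : continuous wgt.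
Proof.
move=> z; apply: continuous_comp; last exact: continuous_expR.
have H := is_derive_bdist z.
apply: differentiable_continuous; apply/derivable1_diffP; exact: derivableM.
Qed.

Lemma continuous_cwgt : continuous cwgt.
Proof. by move=> z; apply: continuousB; [exact: cst_continuous|exact: continuous_wgt]. Qed.

Lemma continuous_dcwgt : continuous dcwgt.
Proof.
move=> z; have H := is_derive_bdist z.
have wz : is_derive z 1 wgt (- lam * (a + b - 2 * z) * wgt z).
  by rewrite /wgt; apply: is_derive_eq; rewrite /GRing.scale /=; ring.
by apply: differentiable_continuous; apply/derivable1_diffP; apply: derivableM.
Qed.

Lemma has_density_cwgt : has_density a b cwgt dcwgt.
Proof.
apply: has_density_C1 => //; last by move=> z _; exact: is_derive_cwgt.
- by apply: continuous_subspaceT; exact: continuous_cwgt.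
- by apply: continuous_subspaceT; exact: continuous_dcwgt.
Qed.

Lemma wgt_ge0 z : 0 <= wgt z. Proof. exact: expR_ge0. Qed.

Lemma wgt_le1 z : z \in `[a, b] -> wgt z <= 1.
Proof.
move=> zab; rewrite /wgt -expR0 ler_expR mulNr oppr_le0.
by rewrite mulr_ge0// bdist_ge0.
Qed.

Lemma cwgt_a : cwgt a = 0.
Proof. by rewrite /cwgt /wgt /bdist subrr mul0r mulr0 expR0 subrr. Qed.

Lemma cwgt_b : cwgt b = 0.
Proof. by rewrite /cwgt /wgt /bdist subrr mulr0 mulr0 expR0 subrr. Qed.

Lemma normr_dcwgt z : z \in `[a, b] -> `|dcwgt z| <= lam * (b - a) * wgt z.
Proof.
rewrite in_itv /= => /andP[az zb].
rewrite /dcwgt normrM (ger0_norm (wgt_ge0 z)) ler_wpM2r ?wgt_ge0//.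
rewrite normrM (ger0_norm lam0) ler_wpM2l// ler_norml; apply/andP; split; lra.
Qed.

Section Energies.
Variables (n : nat) (A B : R -> 'M[R]_n) (f : R -> 'cV[R[i]]_n).
Hypotheses (cA : continuous_mx a b A) (cB : continuous_mx a b B) (f2 : L2vec a b f).

Let cwin (v : R -> R) : continuous v -> {within `[a, b], continuous v}.
Proof. by move=> cv; exact: continuous_subspaceT. Qed.

Lemma energy_cwgt :
  energy a b cwgt A f f = energy a b (cst 1) A f f - energy a b wgt A f f.
Proof.
rewrite /energy -mulrBr -RintegralB//.
- by congr (_ * _); apply: eq_Rintegral => z _; rewrite /cwgt mulrBl.
- by apply: cdot_integrable => // z; exact: cst_continuous.
- by apply: cdot_integrable => //; apply: cwin; exact: continuous_wgt.
Qed.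

Lemma energy_dcwgt_le C :
  (forall z u, z \in `[a, b] -> `|cdot (B z) u u| <= C * cdot (A z) u u) ->
  energy a b dcwgt B f f <= lam * ((b - a) * C) * energy a b wgt A f f.
Proof.
move=> BC; have cw := cwin continuous_wgt; have cd := cwin continuous_dcwgt.
rewrite /energy mulrCA ler_pM2l ?invr_gt0// -RintegralZl//; last exact: cdot_integrable.
apply: le_Rintegral => //; [exact: cdot_integrable|exact/integrable_cstM/cdot_integrable|].
move=> z zab; apply: le_trans (ler_norm _) _; rewrite normrM.
have -> : lam * ((b - a) * C) * (wgt z * cdot (A z) (f z) (f z)) =
  (lam * (b - a) * wgt z) * (C * cdot (A z) (f z) (f z)) by ring.
by apply: ler_pM => //; [exact: normr_dcwgt|exact: BC].
Qed.

Lemma energy_wgt_le del : 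
  (forall z u, z \in `[a, b] -> 0 <= cdot (A z) u u) ->
  (forall z, bdist z < del -> f z = 0) ->
  energy a b wgt A f f <= expR (- lam * del) * energy a b (cst 1) A f f.
Proof.
move=> A0 f0; have cw := cwin continuous_wgt.
have c1 : {within `[a, b], continuous (cst 1 : R -> R)} by apply: cwin; exact: cst_continuous.
rewrite /energy mulrCA ler_pM2l ?invr_gt0// -RintegralZl//; last exact: cdot_integrable.
apply: le_Rintegral => //; [exact: cdot_integrable|exact/integrable_cstM/cdot_integrable|].
move=> z zab; have [zd|zd] := ltP (bdist z) del.
  have -> : cdot (A z) (f z) (f z) = 0; last by rewrite !mulr0.
  by rewrite f0// cdotE big1// => j _; rewrite big1// => i _; rewrite !mxE /= !mul0r addr0 mulr0.
rewrite mulrA mulr1 ler_wpM2r ?A0// ler_expR !mulNr lerN2.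
by rewrite ler_wpM2l.
Qed.

End Energies.
End Weight.

(** As A is bounded below, its form dominates that of any bounded matrix. For A = H
and B = H P1 H the constant C plays the role of a propagation speed. *)
Lemma cdot_relative_bound (R : realType) (a b m : R) (n : nat) (A B : R -> 'M[R]_n) :
  0 < m -> (forall z, z \in `[a, b] -> loewner_le m%:M (A z)) ->
  continuous_mx a b B ->
  exists2 C, 0 < C &
  (forall z u, z \in `[a, b] -> `|cdot (B z) u u| <= C * cdot (A z) u u).
Proof.
move=> m0 mA cB; have [C0 HC0] := continuous_mx_bounded cB.
exists (n%:R * `|C0| / m + 1).
  by rewrite ltr_wpDl// divr_ge0 ?mulr_ge0// ltW.
move=> z u zab; have H1 := loewner_cdot u (mA z zab).
have H2 : `|cdot (B z) u u| <= n%:R * `|C0| * sqnorm u.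
  by apply: cdot_bound => i j; apply: le_trans (HC0 i j z zab) (ler_norm _).
apply: le_trans H2 _.
have H3 : 0 <= cdot (A z) u u by apply: le_trans H1; rewrite mulr_ge0 ?sqnorm_ge0// ltW.
rewrite mulrDl mul1r -[leLHS]addr0; apply: lerD => //.
rewrite -!mulrA ler_wpM2l// ler_wpM2l//.
by rewrite ler_pdivlMl.
Qed.

(** * A domain element supported away from the boundary *)

Section Bump.
Context (R : realType).
Local Notation mu := (@lebesgue_measure R).

(** The remainder of the first order expansion at s is at most h ^+ 2, on both sides
of the kink as well as across it. *)
Lemma is_derive_sqr_pos (s : R) :
  is_derive s 1 (fun s => Num.max 0 s ^+ 2) (2 * Num.max 0 s).
Proof.
have bnd h : h != 0 ->
    `|2 * Num.max 0 s - h^-1 * (Num.max 0 (h + s) ^+ 2 - Num.max 0 s ^+ 2)| <= `|h|.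
  move=> h0; rewrite -(ler_pM2l (x := `|h|)) ?normr_gt0// -normrM mulrBr.
  rewrite mulVKf// -expr2 real_normK ?num_real// ler_norml.
  by case: (leP 0 s) => s0; case: (leP 0 (h + s)) => hs0; apply/andP; split; nra.
have L : h^-1 *: (Num.max 0 (h *: 1 + s) ^+ 2 - Num.max 0 s ^+ 2) @[h --> 0^'] -->
    2 * Num.max 0 s.
  apply/cvgrPdist_le => e e0; near=> h.
  have h0 : h != 0 by near: h; exact: nbhs_dnbhs_neq.
  rewrite /GRing.scale /= mulr1; apply: le_trans (bnd h h0) _.
  near: h; exact: dnbhs0_le.
apply: DeriveDef; first by apply/cvg_ex; exists (2 * Num.max 0 s).
exact: cvg_lim L.
Unshelve. all: by end_near. Qed.

Variables (a b : R).
Hypothesis ab : a < b.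

(** Half of the maximum of bdist on [a, b], which is (b - a)^2 / 4. *)
Definition margin : R := (b - a) ^+ 2 / 8.
Definition bump z : R := Num.max 0 (bdist a b z - margin) ^+ 2.
Definition dbump z : R := 2 * Num.max 0 (bdist a b z - margin) * (a + b - 2 * z).

Lemma is_derive_bump (z : R) : is_derive z 1 bump (dbump z).
Proof.
have H1 := is_derive_bdist a b z.
have H2 : is_derive z 1 (fun z => bdist a b z - margin) (a + b - 2 * z).
  by apply: is_derive_eq; rewrite subr0.
have H3 := is_derive_sqr_pos (bdist a b z - margin).
have H4 := @is_derive1_comp _ (fun s => Num.max 0 s ^+ 2)
  (fun z => bdist a b z - margin) z _ _ H3 H2.
by apply: (is_derive_eq H4); rewrite /dbump /GRing.scale /=; ring.
Qed.

Lemma continuous_bump : continuous bump.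
Proof.
move=> z; apply: differentiable_continuous; apply/derivable1_diffP.
by have := is_derive_bump z => -[].
Qed.

Lemma continuous_dbump : continuous dbump.
Proof.
have E : dbump = fun z => ((bdist a b z - margin) + `|bdist a b z - margin|) * (a + b - 2 * z).
  apply/funext => z; rewrite /dbump; congr (_ * _).
  by case: (leP 0 (bdist a b z - margin)) => h; [rewrite ger0_norm//|rewrite ltr0_norm//]; ring.
rewrite E => z.
have cb : continuous (fun z => bdist a b z - margin).
  move=> y; have H1 := is_derive_bdist a b y.
  by apply: differentiable_continuous; apply/derivable1_diffP.
have cl : continuous (fun z : R => a + b - 2 * z).
  by move=> y; apply: differentiable_continuous; apply/derivable1_diffP.
exact: (cvgM (cvgD (cb z) (cvg_norm (cb z))) (cl z)).
Qed.

Lemma margin_gt0 : 0 < margin.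
Proof. by rewrite divr_gt0// exprn_gt0// subr_gt0. Qed.

Lemma bump0 z : bdist a b z <= margin -> bump z = 0.
Proof. by move=> zm; rewrite /bump max_l ?subr_le0// expr0n. Qed.

Lemma has_density_bump : has_density a b bump dbump.
Proof.
apply: has_density_C1 => //; last by move=> z _; exact: is_derive_bump.
- by apply: continuous_subspaceT; exact: continuous_bump.
- by apply: continuous_subspaceT; exact: continuous_dbump.
Qed.

(** On the middle half of [a, b], bdist is at least 3 (b - a)^2 / 16 and so exceeds
the margin by (b - a)^2 / 16. *)
Lemma bump_square_integral_gt0 : 0 < \int[mu]_(z in `[a, b]) (bump z ^+ 2).
Proof.
pose L := b - a; pose c := (a + b) / 2; pose k := ((L ^+ 2 / 16) ^+ 2) ^+ 2.
have L0 : 0 < L by rewrite subr_gt0.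
have k0 : 0 < k by rewrite !exprn_gt0// divr_gt0// exprn_gt0.
have bk z : z \in `[c - L / 4, c + L / 4] -> k <= bump z ^+ 2.
  rewrite in_itv /= => /andP[z1 z2].
  have h : L ^+ 2 / 16 <= bdist a b z - margin.
    have : (z - c) ^+ 2 <= (L / 4) ^+ 2.
      rewrite -ler_sqrt ?sqr_ge0// !sqrtr_sqr (ger0_norm (x := L / 4)).
        2: by rewrite divr_ge0// ltW.
      by rewrite ler_norml; apply/andP; split; lra.
    by rewrite /bdist /margin /c /L; move=> ?; nra.
  have L16 : 0 <= L ^+ 2 / 16 by rewrite divr_ge0// sqr_ge0.
  by rewrite /k /bump max_r ?(le_trans _ h)// !lerXn2r ?nnegrE ?sqr_ge0// (le_trans _ h).
have sub : `[c - L / 4, c + L / 4] `<=` `[a, b].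
  move=> z /=; rewrite !in_itv /= => /andP[z1 z2].
  by apply/andP; split; move: z1 z2; rewrite /c /L; lra.
have cb2 : {within `[a, b], continuous (fun z => bump z ^+ 2)}.
  have cb : continuous (fun z => bump z ^+ 2).
    move=> z; have H := is_derive_bump z.
    by apply: differentiable_continuous; apply/derivable1_diffP.
  exact: continuous_subspaceT.
have bi : mu.-integrable `[a, b] (EFin \o (fun z => bump z ^+ 2)).
  by apply: continuous_compact_integrable => //; exact: segment_compact.
apply: (@lt_le_trans _ _ (k * (L / 2))); first by rewrite mulr_gt0// divr_gt0.
rewrite -lee_fin -integral_EFin_Rintegral//.
apply: (@le_trans _ _ (\int[mu]_(z in `[(c - L / 4)%R, (c + L / 4)%R]) (k%:E)))%E.
  rewrite integral_cst//= lebesgue_measure_itv/= lte_fin ifT; last by lra.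
  by rewrite -EFinB -EFinM lee_fin; rewrite le_eqVlt; apply/orP; left; apply/eqP; field.
apply: (@le_trans _ _ (\int[mu]_(z in `[(c - L / 4)%R, (c + L / 4)%R]) ((bump z ^+ 2)%:E)))%E.
  apply: ge0_le_integral => //.
  - by move=> z _; rewrite lee_fin ltW.
  - have bi' : mu.-integrable `[c - L / 4, c + L / 4] (EFin \o (fun z => bump z ^+ 2)).
      by apply: integrableS bi.
    exact: measurable_int bi'.
apply: ge0_subset_integral => //; first exact: measurable_int bi.
by move=> z _; rewrite lee_fin sqr_ge0.
Qed.

End Bump.

Section Domain.
Context (R : realType) (a b : R) (n : nat) (K : set R[i]).
Local Notation mu := (@lebesgue_measure R).
Hypothesis ab : a < b.
Hypothesis K_real : forall x : R, K (x%:C)%C.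

Lemma L2_complex_mx (p : R -> 'cV[R]_n) :
  continuous_mx a b p ->
  L2 a b K (fun z => complex_mx (p z)).
Proof.
move=> cp i; split.
- by move=> z _; rewrite mxE.
- apply/Lfun2_patchP; rewrite (_ : (fun=> _) = fun z => p z i 0).
    exact: continuous_square_integrable (cp i 0).
  by apply/funext => z; rewrite mxE.
- apply/Lfun2_patchP; rewrite (_ : (fun=> _) = cst 0).
    by apply: continuous_square_integrable => z; exact: cst_continuous.
  by apply/funext => z; rewrite mxE.
Qed.

Lemma complex_mxM m p q (A : 'M[R]_(m, p)) (B : 'M[R]_(p, q)) :
  complex_mx (A *m B) = complex_mx A *m complex_mx B.
Proof. exact: map_mxM. Qed.

(** Take x0 = bump * e_0. Then H x0 is C^1 and vanishes at a and b, so that its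
boundary port is 0. *)
Lemma ex_interior_domain (P1 P0 : 'M[R]_n) (H : R -> 'M[R]_n) (WB : 'M[R]_(n, n + n)) m :
  (0 < n)%N -> C1_mx a b H -> 0 < m ->
  (forall z, z \in `[a, b] -> loewner_le m%:M (H z)) ->
  exists x0 g0, [/\ port_hamiltonian a b K P1 P0 H WB x0 g0,
    (forall z, bdist a b z < margin a b -> x0 z = 0) &
    0 < energy a b (cst 1) H x0 x0].
Proof.
move=> n0 [dH HC1] m0 mH; pose i0 := Ordinal n0.
have cH : continuous_mx a b H by move=> i j; have [] := HC1 i j.
have cdH : continuous_mx a b dH by move=> i j; have [] := HC1 i j.
have dHd i j : has_density a b (fun z => H z i j) (fun z => dH z i j).
  by have [? ? ?] := HC1 i j; exact: has_density_C1.
pose xr z : 'cV[R]_n := bump a b z *: delta_mx i0 0.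
pose yr z : 'cV[R]_n := H z *m xr z.
pose dyr z : 'cV[R]_n := \col_i (bump a b z * dH z i i0 + H z i i0 * dbump a b z).
pose gr z : 'cV[R]_n := P1 *m dyr z + P0 *m yr z.
have wT (f : R -> R) : continuous f -> {within `[a, b], continuous f}.
  by move=> ?; exact: continuous_subspaceT.
have cb := wT _ (@continuous_bump R a b); have cdb := wT _ (@continuous_dbump R a b).
have cx : continuous_mx a b xr.
  move=> i j; rewrite (ord1 j).
  rewrite (_ : (fun=> _) = fun z => bump a b z * (delta_mx i0 0 : 'cV[R]_n) i 0).
    by move=> z; exact: (cvgM (cb z) (cvg_cst _)).
  by apply/funext => z; rewrite mxE.
have cy := continuous_mxM cH cx.
have cdy : continuous_mx a b dyr.
  move=> i j; rewrite (ord1 j).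
  rewrite (_ : (fun=> _) = fun z => bump a b z * dH z i i0 + H z i i0 * dbump a b z).
    by move=> z; exact: (cvgD (cvgM (cb z) (cdH i i0 z)) (cvgM (cH i i0 z) (cdb z))).
  by apply/funext => z; rewrite mxE.
have cg : continuous_mx a b gr.
  move=> i j; rewrite (ord1 j).
  rewrite (_ : (fun=> _) = fun z => (P1 *m dyr z) i 0 + (P0 *m yr z) i 0).
    have c1 := continuous_mxM (@continuous_mx_cst R a b n n P1) cdy.
    have c0 := continuous_mxM (@continuous_mx_cst R a b n n P0) cy.
    by move=> z; exact: (cvgD (c1 i 0 z) (c0 i 0 z)).
  by apply/funext => z; rewrite mxE.
have yE z i : yr z i 0 = bump a b z * H z i i0.
  by rewrite /yr /xr -scalemxAr mxE -colE mxE.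
have cE (p : R -> 'cV[R]_n) z i : complex_mx (p z) i 0 = ((p z i 0)%:C)%C by rewrite mxE.
exists (fun z => complex_mx (xr z)), (fun z => complex_mx (gr z)); split.
- split; [exact: L2_complex_mx|exact: L2_complex_mx|].
  exists (fun z => complex_mx (yr z)), (fun z => complex_mx (dyr z)); split.
  + split; [exact: L2_complex_mx|exact: L2_complex_mx|].
    move=> z zab; apply/colP => i; rewrite [RHS]mxE [vintegral _ _ i 0]mxE !cE !yE.
    have [_ /(_ z zab) ->] := has_densityM (ltW ab) (has_density_bump ab) (dHd i i0).
    rewrite /cintegral; apply/eqP; rewrite eq_complex /=; apply/andP; split; apply/eqP.
      by congr (_ + _); apply: eq_Rintegral => s _; rewrite cE mxE.
    rewrite add0r /Rintegral; symmetry; apply: (congr1 fine (y := 0%E)).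
    by apply: integral0_eq => s _; rewrite cE.
  + exists set0; split => // z /=; apply: contra_notP => _ _.
    by rewrite complex_mxM.
  + have y0 z : bdist a b z = 0 -> complex_mx (yr z) = 0.
      move=> z0; rewrite /yr /xr bump0 ?z0 ?ltW ?margin_gt0// scale0r mulmx0.
      by apply/colP => i; rewrite !mxE.
    rewrite /boundary_port !y0; last 2 first.
    - by rewrite /bdist subrr mul0r.
    - by rewrite /bdist subrr mulr0.
    by rewrite col_mx0 mulmx0 scaler0 mulmx0.
  + exists set0; split => // z /=; apply: contra_notP => _ _.
    by rewrite -!complex_mxM; exact: map_mxD.
- by move=> z zm; rewrite /xr bump0 ?ltW// scale0r; apply/colP => i; rewrite !mxE.
- apply: mulr_gt0; first by rewrite invr_gt0.
  apply: lt_le_trans (mulr_gt0 m0 (bump_square_integral_gt0 ab)) _.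
  have x2 := L2_L2vec (L2_complex_mx cx).
  have c1 : {within `[a, b], continuous (cst 1 : R -> R)}.
    by apply: wT; exact: cst_continuous.
  have bi : mu.-integrable `[a, b] (EFin \o (fun z => bump a b z ^+ 2)).
    have [_] := continuous_square_integrable cb; exact.
  rewrite -RintegralZl//; apply: le_Rintegral => //.
  - exact: integrable_cstM.
  - exact: cdot_integrable.
  move=> z zab; rewrite mul1r; apply: le_trans (loewner_cdot _ (mH z zab)).
  rewrite ler_wpM2l ?(ltW m0)// /sqnorm (bigD1 i0)//= !mxE !eqxx mulr1 /=.
  rewrite expr0n addr0 lerDl; apply: sumr_ge0 => i _.
  by rewrite addr_ge0 ?sqr_ge0.
Qed.
End Domain.


(** * Contraction semigroups on classes of representatives *)

Section AbstractSemigroup.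
Context (R : realType) (F : lmodType R[i]).
Variables (K : set R[i]) (X : set F) (eqv : F -> F -> Prop) (nrm : F -> R).

(** What the semigroup arguments need from L^2: a seminorm on representatives that
does not distinguish equivalent ones. *)
Record seminormed_classes : Prop := SeminormedClasses {
  snc_real : forall x : R, K (x%:C)%C;
  snc_zero : X 0;
  snc_lin : forall (c : R) f g, X f -> X g -> X (c%:C%C *: f + g);
  snc_refl : forall f, eqv f f;
  snc_sym : forall f g, eqv f g -> eqv g f;
  snc_trans : forall f g h, eqv f g -> eqv g h -> eqv f h;
  snc_eqv_lin : forall (c : R[i]) f f' g g', eqv f f' -> eqv g g' ->
    eqv (c *: f + g) (c *: f' + g');
  snc_nrm_eqv : forall f g, X f -> X g -> eqv f g -> nrm f = nrm g;
  snc_nrmZ : forall (c : R) f, 0 <= c -> X f -> nrm (c%:C%C *: f) = c * nrm f;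
  snc_nrm_ge0 : forall f, 0 <= nrm f }.

Hypothesis snc : seminormed_classes.

Let XZ (c : R) f : X f -> X (c%:C%C *: f).
Proof. by move=> Xf; rewrite -[_ *: _]addr0; apply: (snc_lin snc) => //; exact: (snc_zero snc). Qed.

Let XB f g : X f -> X g -> X (f - g).
Proof.
move=> Xf Xg; have := snc_lin snc (-1) Xg Xf.
by rewrite rmorphN1 scaleN1r addrC.
Qed.

Let eqvZ (c : R[i]) f f' : eqv f f' -> eqv (c *: f) (c *: f').
Proof.
by move=> e; have := snc_eqv_lin snc c e (snc_refl snc 0); rewrite !addr0.
Qed.

Let eqvB f f' g g' : eqv f f' -> eqv g g' -> eqv (f - g) (f' - g').
Proof.
move=> e e'; have := snc_eqv_lin snc (-1) e' e.
by rewrite !scaleN1r addrC [- g' + _]addrC.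
Qed.

Section Operator.
Variable S : F -> F.
Hypothesis bS : bounded_operator K X eqv nrm S.

Lemma op_lin (c : R) f g : X f -> X g ->
  eqv (S (c%:C%C *: f + g)) (c%:C%C *: S f + S g).
Proof. by move=> Xf Xg; apply: (bop_linear bS) => //; exact: (snc_real snc). Qed.

Lemma op0 : eqv (S 0) 0.
Proof.
have X0 := snc_zero snc; have := op_lin (-1) X0 X0.
by rewrite rmorphN1 !scaleN1r oppr0 addr0 addNr.
Qed.

Lemma opZ (c : R) f : X f -> eqv (S (c%:C%C *: f)) (c%:C%C *: S f).
Proof.
move=> Xf; have := op_lin c Xf (snc_zero snc); rewrite addr0 => e.
apply: (snc_trans snc e); rewrite -[X in eqv _ X]addr0.
by apply: (snc_eqv_lin snc) op0; exact: (snc_refl snc).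
Qed.

Lemma opB f g : X f -> X g -> eqv (S (f - g)) (S f - S g).
Proof.
move=> Xf Xg; have := op_lin (-1) Xg Xf.
by rewrite rmorphN1 !scaleN1r addrC [- S g + _]addrC.
Qed.

Lemma op_quotient (c : R) f f' g : X f -> X f' -> X g ->
  eqv (S (c%:C%C *: (f - f') - g)) (c%:C%C *: (S f - S f') - S g).
Proof.
move=> Xf Xf' Xg; apply: (snc_trans snc (opB (XZ c (XB Xf Xf')) Xg)).
apply: eqvB; last exact: (snc_refl snc).
apply: (snc_trans snc (opZ _ (XB Xf Xf'))); exact/eqvZ/opB.
Qed.

Lemma nrm_le_opnorm f : X f -> nrm f <= 1 -> nrm (S f) <= opnorm X nrm S.
Proof.
move=> Xf f1; apply: ub_le_sup; last by exists f.
have [C HC] := bop_bounded bS; exists `|C| => _ [g [Xg g1] <-].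
apply: le_trans (HC _ Xg) _; apply: le_trans (ler_norm _) _.
by rewrite normrM -[leRHS]mulr1 ler_wpM2l// ger0_norm ?(snc_nrm_ge0 snc).
Qed.

(** A null representative cannot be normalized; for it the boundedness of S, with any
constant, gives the claim. *)
Lemma nrm_op_le f : X f -> nrm (S f) <= opnorm X nrm S * nrm f.
Proof.
move=> Xf; have := snc_nrm_ge0 snc f; rewrite le_eqVlt => /predU1P[f0|f0].
  by have [C HC] := bop_bounded bS; have := HC _ Xf; rewrite -f0 !mulr0.
have Xf' := XZ (nrm f)^-1 Xf.
have i0 : 0 <= (nrm f)^-1 by rewrite invr_ge0 ltW.
have := nrm_le_opnorm Xf'; rewrite (snc_nrmZ snc)//.
rewrite mulVf ?gt_eqF// => /(_ (lexx _)).
rewrite (snc_nrm_eqv snc _ _ (opZ _ Xf)).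
- rewrite (snc_nrmZ snc)//; last exact: (bop_stable bS).
  by rewrite ler_pdivrMl// mulrC.
- exact: (bop_stable bS).
- by apply: XZ; exact: (bop_stable bS).
Qed.

End Operator.

Variable T : R -> F -> F.
Hypothesis cT : contraction_semigroup K X eqv nrm T.

Lemma sg_nrm_le t f : 0 <= t -> X f -> nrm (T t f) <= nrm f.
Proof.
move=> t0 Xf; have [sg /(_ _ t0) T1] := cT.
apply: le_trans (nrm_op_le (sg_bounded sg t0) Xf) _.
by rewrite -[leRHS]mul1r ler_wpM2r ?(snc_nrm_ge0 snc).
Qed.

Lemma opnorm_eq1 t f : 0 <= t -> X f -> 0 < nrm f -> nrm f <= nrm (T t f) ->
  opnorm X nrm (T t) = 1.
Proof.
move=> t0 Xf f0 fT; have [sg /(_ _ t0) T1] := cT.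
apply/eqP; rewrite eq_le T1/= -(ler_pM2r f0) mul1r.
exact: le_trans fT (nrm_op_le (sg_bounded sg t0) Xf).
Qed.

Lemma sg_X t f : 0 <= t -> X f -> X (T t f).
Proof. by move=> t0; have [sg _] := cT; exact: (bop_stable (sg_bounded sg t0)). Qed.

(** f' stands for T (t + h) f or for the equivalent T h (T t f). *)
Let quot_le t h f g : 0 <= t -> 0 <= h -> X f -> X g ->
  forall f', X f' -> eqv f' (T (t + h) f) ->
  nrm ((h^-1)%:C%C *: (f' - T t f) - T t g) <=
  nrm ((h^-1)%:C%C *: (T h f - f) - g).
Proof.
move=> t0 h0 Xf Xg f' Xf' ef'; have [sg _] := cT.
have Xr : X ((h^-1)%:C%C *: (T h f - f) - g).
  by apply: XB => //; apply: XZ; apply: XB => //; exact: sg_X.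
apply: le_trans (sg_nrm_le t0 Xr).
rewrite le_eqVlt; apply/orP; left; apply/eqP; apply: (snc_nrm_eqv snc).
- by apply: XB; [apply: XZ; apply: XB|]; rewrite ?sg_X//; exact: sg_X.
- exact: sg_X.
apply: (snc_sym snc); apply: (snc_trans snc (op_quotient (sg_bounded sg t0) _ _ _ _)) => //.
  exact: sg_X.
apply: eqvB; last exact: (snc_refl snc).
apply: eqvZ; apply: eqvB; last exact: (snc_refl snc).
apply: (snc_trans snc _ (snc_sym snc ef')); apply: (snc_sym snc); exact: (sg_add sg).
Qed.

(** The difference quotient at time t is the image under T t of the one at time 0, so
a contraction makes its convergence uniform in t. *)
Lemma generator_uniform f g : generator X nrm T f g -> forall e, 0 < e ->
  exists2 eta, 0 < eta & forall t h, 0 <= t -> 0 < h < eta ->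
  nrm ((h^-1)%:C%C *: (T (t + h) f - T t f) - T t g) <= e.
Proof.
move=> [Xf Xg] /cvgrPdist_le H e e0; have := H e e0.
rewrite near_withinE => -[eta /= eta0 Heta]; exists eta => // t h t0 /andP[h0 heta].
have := Heta h; rewrite /= !sub0r !normrN (gtr0_norm h0) => /(_ heta h0).
rewrite ger0_norm ?(snc_nrm_ge0 snc)//; apply: le_trans.
apply: quot_le => //; rewrite ?ltW//; last exact: (snc_refl snc).
by apply: sg_X; rewrite // addr_ge0// ltW.
Qed.

Lemma generator_invariant f g t : 0 <= t -> generator X nrm T f g ->
  generator X nrm T (T t f) (T t g).
Proof.
move=> t0 [Xf Xg lim0]; split; [exact: sg_X|exact: sg_X|].
apply: (squeeze_cvgr _ (cvg_cst 0) lim0).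
rewrite near_withinE; near=> h => h0; rewrite (snc_nrm_ge0 snc)/=.
have [sg _] := cT; apply: quot_le => //; rewrite ?ltW//.
  by apply: sg_X; [exact: ltW|exact: sg_X].
apply: (snc_sym snc); rewrite addrC; apply: (sg_add sg) => //; exact: ltW.
Unshelve. all: by end_near. Qed.

End AbstractSemigroup.

(** * A discrete Gronwall inequality *)

(** The assumption is a forward Euler step whose error is small compared with the
step length, uniformly in time. Iterating it over N equal steps of length t / N
bounds u by the exponential, up to a multiple of e; no derivative of u is involved. *)
Lemma Gronwall (R : realType) (u : R -> R) (m : R) : 0 <= m -> 0 <= u 0 ->
  (forall e, 0 < e -> exists2 eta, 0 < eta & forall t h, 0 <= t -> 0 < h < eta ->
     u (t + h) <= (1 + m * h) * u t + e * h) ->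
  forall t, 0 <= t -> u t <= expR (m * t) * u 0.
Proof.
move=> m0 u0 Hu t; rewrite le_eqVlt => /predU1P[<-|t0].
  by rewrite mulr0 expR0 mul1r.
apply/ler_addgt0Pr => d d0; pose e := d / (expR (m * t) * t).
have e0 : 0 < e by rewrite divr_gt0// mulr_gt0// expR_gt0.
have [eta eta0 H] := Hu e e0.
pose N := (Num.truncn (t / eta)).+1; pose h := t / N%:R.
have N0 : 0 < N%:R :> R by rewrite ltr0n.
have h0 : 0 < h by rewrite divr_gt0.
have heta : h < eta.
  rewrite /h ltr_pdivrMr// mulrC -ltr_pdivrMr//; exact: truncnS_gt.
have step k : u (k%:R * h) <= expR (m * (k%:R * h)) * (u 0 + k%:R * (e * h)).
  elim: k => [|k IH]; first by rewrite !mul0r mulr0 expR0 mul1r addr0.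
  have kh0 : 0 <= k%:R * h by rewrite mulr_ge0// ltW.
  have := H (k%:R * h) h kh0; rewrite h0 heta => /(_ isT).
  have -> : k.+1%:R * h = k%:R * h + h by rewrite -natr1; ring.
  move=> /le_trans; apply.
  have mh : 0 <= m * h by rewrite mulr_ge0// ltW.
  rewrite [m * (_ + h)]mulrDr expRD.
  have E1 : 1 + m * h <= expR (m * h) by exact: expR_ge1Dx.
  have E2 : 1 <= expR (m * (k%:R * h)) by apply: le_trans (expR_ge1Dx _); rewrite lerDl mulr_ge0.
  have P : 0 <= u 0 + k%:R * (e * h) by rewrite addr_ge0// mulr_ge0// mulr_ge0// ltW.
  have -> : u 0 + k.+1%:R * (e * h) = (u 0 + k%:R * (e * h)) + e * h.
    by rewrite -natr1; ring.
  rewrite mulrDr; apply: lerD.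
    apply: (@le_trans _ _ ((1 + m * h) * (expR (m * (k%:R * h)) * (u 0 + k%:R * (e * h))))).
      by rewrite ler_wpM2l// addr_ge0.
    rewrite [leRHS](_ : _ = expR (m * h) *
      (expR (m * (k%:R * h)) * (u 0 + k%:R * (e * h)))); last by ring.
    by rewrite ler_wpM2r// mulr_ge0// expR_ge0.
  rewrite -[leLHS]mul1r ler_wpM2r//; first by rewrite mulr_ge0// ltW.
  by rewrite mulr_ege1//; apply: le_trans E1; rewrite lerDl.
have := step N; have -> : N%:R * h = t by rewrite /h mulrC divfK ?gt_eqF.
move=> /le_trans; apply; rewrite mulrDr lerD2l.
have -> : N%:R * (e * h) = e * t by rewrite mulrCA /h [N%:R * _]mulrC divfK ?gt_eqF.
by rewrite mulrCA /e divfK// gt_eqF// mulr_gt0// expR_gt0.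
Qed.

(** * Finite speed of propagation *)

Section PortHamiltonianSemigroup.
Context (R : realType) (a b : R) (n : nat) (K : set R[i]).
Hypothesis ab : a < b.
Hypothesis K_field : K = range (real_complex R) \/ K = [set: R[i]].
Variables (P1 P0 : 'M[R]_n) (H : R -> 'M[R]_n) (WB : 'M[R]_(n, n + n)).
Hypotheses (cH : continuous_mx a b H) (sH : forall z, z \in `[a, b] -> (H z)^T = H z).
Hypothesis H0 : forall z u, z \in `[a, b] -> 0 <= cdot (H z) u u.

Local Notation L2K := (@L2 R a b n K).
Local Notation normX := (@Xnorm R a b n H).
Local Notation V lam f := (energy a b (cwgt a b lam) H f f).
Local Notation E1 f := (energy a b (cst 1) H f f).

Lemma K_real (x : R) : K (x%:C)%C.
Proof. by case: K_field => -> //; exists x. Qed.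

Lemma K_lin (x : R) y z : K y -> K z -> K ((x%:C)%C * y + z).
Proof.
case: K_field => -> //= -[y' _ <-] [z' _ <-]; exists (x * y' + z') => //.
by rewrite rmorphD rmorphM.
Qed.

Lemma L2P f : L2K f <-> (forall i z, z \in `[a, b] -> K (f z i 0)) /\ L2vec a b f.
Proof.
split=> [fK|[fK f2] i]; first by split; [move=> i; have [] := fK i|exact: L2_L2vec fK].
by have [fr fi] := f2 i; split; [exact: fK|exact/Lfun2_patchP|exact/Lfun2_patchP].
Qed.

Let c1 : {within `[a, b], continuous (cst 1 : R -> R)}.
Proof. by apply: continuous_subspaceT; exact: cst_continuous. Qed.

Lemma energy1_ge0 f : 0 <= E1 f.
Proof. by apply: energy_ge0 => // z _; exact: ler01. Qed.

Lemma sqr_Xnorm f : normX f ^+ 2 = E1 f.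
Proof. by rewrite XnormE sqr_sqrtr// energy1_ge0. Qed.

Lemma L2_seminormed : seminormed_classes K L2K (L2_eq a b) normX.
Proof.
split.
- exact: K_real.
- apply/L2P; split=> [i z _|i]; first by rewrite mxE; exact: (K_real 0).
  by split; rewrite (_ : (fun=> _) = cst 0); try (by apply/funext => z; rewrite mxE);
    apply: continuous_square_integrable => z; exact: cst_continuous.
- move=> c f g /L2P[fK f2] /L2P[gK g2]; apply/L2P; split; last exact: L2vec_lin.
  by move=> i z zab; rewrite !mxE; apply: K_lin; [exact: fK|exact: gK].
- by move=> f; exists set0; split => // z /=; apply: contra_notP.
- move=> f g [N [mN N0 fgN]]; exists N; split => // z /= ne; apply: fgN => /= fg.
  by apply: ne => zab; rewrite fg.
- move=> f g h [N [mN N0 fgN]] [M [mM M0 ghM]]; exists (N `|` M); split.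
  + exact: measurableU.
  + exact: null_set_setU.
  move=> z /= ne; apply: contrapT => /not_orP[zN zM]; apply: ne => zab.
  transitivity (g z); apply: contrapT => ne.
    by apply: zN; apply: fgN => /= /(_ zab).
  by apply: zM; apply: ghM => /= /(_ zab).
- move=> c f f' g g' [N [mN N0 fgN]] [M [mM M0 ghM]]; exists (N `|` M); split.
  + exact: measurableU.
  + exact: null_set_setU.
  move=> z /= ne; apply: contrapT => /not_orP[zN zM]; apply: ne => zab.
  have fz : f z = f' z by apply: contrapT => ne; apply: zN; apply: fgN => /= /(_ zab).
  have gz : g z = g' z by apply: contrapT => ne; apply: zM; apply: ghM => /= /(_ zab).
  by rewrite [LHS]/= [RHS]/= -[LHS]/(c *: f z + g z) -[RHS]/(c *: f' z + g' z) fz gz.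
- by move=> f g /L2_L2vec f2 /L2_L2vec g2 fg; rewrite !XnormE (energy_ae c1 cH f2 g2 fg).
- move=> c f c0 /L2_L2vec f2; rewrite !XnormE.
  have -> : energy a b (cst 1) H (c%:C%C *: f) (c%:C%C *: f) = c ^+ 2 * E1 f.
    rewrite /energy mulrCA; congr (_ * _).
    rewrite -RintegralZl//; last exact: cdot_integrable.
    apply: eq_Rintegral => z zab; rewrite /= !mul1r.
    exact: cdotZ.
  by rewrite sqrtrM ?sqr_ge0// sqrtr_sqr ger0_norm.
- by move=> f; exact: sqrtr_ge0.
Qed.

(** One time step x -> x + h (g + e) with g = A x and an error e of norm at most eps.
The quadratic term in h is nonnegative and dropped. The term linear in g is, by
integration by parts, controlled by the energy near the boundary, which is at most
N0 - V x. The term linear in e is bounded below by expanding V (eps x + e) >= 0. *)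
Lemma cwgt_energy_step lam C N0 x g e h eps : 0 <= lam -> 0 <= C -> 0 < h -> 0 < eps ->
  P1^T = P1 -> P0^T = - P0 ->
  (forall z u, z \in `[a, b] -> `|cdot (H z *m P1 *m H z) u u| <= C * cdot (H z) u u) ->
  port_hamiltonian a b K P1 P0 H WB x g -> L2vec a b e ->
  E1 x <= N0 -> E1 e <= eps ^+ 2 ->
  V lam x - h * (lam * ((b - a) * C) * (N0 - V lam x)) - h * (eps * (N0 + 1)) <=
  V lam (h%:C%C *: (g + e) + x).
Proof.
move=> lam0 C0 h0 eps0 sP1 sP0 HC phx e2 xN eeps.
have x2 : L2vec a b x by case: phx => /L2_L2vec.
have g2 : L2vec a b g by case: phx => _ /L2_L2vec.
have cv : {within `[a, b], continuous (cwgt a b lam)}.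
  by apply: continuous_subspaceT; exact: continuous_cwgt.
have cw : {within `[a, b], continuous (wgt a b lam)}.
  by apply: continuous_subspaceT; exact: continuous_wgt.
have cHPH := continuous_mxM (continuous_mxM cH (@continuous_mx_cst R a b n n P1)) cH.
have v01 z : z \in `[a, b] -> 0 <= cwgt a b lam z <= 1.
  move=> zab; rewrite subr_ge0 wgt_le1//= lerBlDr lerDl; exact: wgt_ge0.
have V0 f : 0 <= V lam f by apply: energy_ge0 => // z /v01 /andP[].
have VN f : L2vec a b f -> V lam f <= E1 f.
  by move=> f2; apply: le_energy => // z /v01 /andP[].
have ge2 : L2vec a b (g + e).
  by have := L2vec_lin 1 g2 e2; rewrite scale1r.
have B1 : 2 * energy a b (cwgt a b lam) H x g >= - (lam * ((b - a) * C) * (N0 - V lam x)).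
  rewrite (energy_generator ab sP1 sP0 cH sH (has_density_cwgt ab lam) _
    (cwgt_a a b lam) (cwgt_b a b lam) cHPH phx); last first.
    by apply: continuous_subspaceT; exact: continuous_dcwgt.
  rewrite lerN2; apply: le_trans (energy_dcwgt_le lam0 cH cHPH x2 HC) _.
  rewrite ler_wpM2l ?mulr_ge0 ?subr_ge0 ?(ltW ab)//.
  by rewrite energy_cwgt// opprB addrCA lerDl subr_ge0.
have B2 : 2 * energy a b (cwgt a b lam) H x e >= - (eps * (N0 + 1)).
  have := V0 (eps%:C%C *: x + e); rewrite energy_expand// .
  have := VN _ x2; have := VN _ e2; set B := energy _ _ _ _ x e => Ve Vx.
  move=> Vxe; rewrite -(ler_pM2l eps0).
  have := ler_wpM2l (sqr_ge0 eps) (le_trans Vx xN).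
  move: Vxe (le_trans Ve eeps); rewrite {}/B.
  move: (V lam x) (V lam e) (energy _ _ _ _ x e) => v1 v2 v3; lra.
have -> : V lam (h%:C%C *: (g + e) + x) = h ^+ 2 * V lam (g + e) +
   h * (2 * energy a b (cwgt a b lam) H x g + 2 * energy a b (cwgt a b lam) H x e) + V lam x.
  rewrite energy_expand//.
  have -> : energy a b (cwgt a b lam) H (g + e) x =
      energy a b (cwgt a b lam) H x g + energy a b (cwgt a b lam) H x e.
    have := energy_linl 1 cv cH g2 e2 x2; rewrite scale1r mul1r => ->.
    by congr (_ + _); apply: energyC.
  move: (V lam (g + e)) (V lam x) (energy _ _ _ _ x g) (energy _ _ _ _ x e) => *; ring.
have V2 : 0 <= h ^+ 2 * V lam (g + e) by rewrite mulr_ge0 ?sqr_ge0.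
have {}B1 := ler_wpM2l (ltW h0) B1; have {}B2 := ler_wpM2l (ltW h0) B2.
rewrite [h * (_ + _)]mulrDr; move: V2 B1 B2; rewrite !mulrN.
move: (h ^+ 2 * _) (h * (2 * _)) (h * (2 * _)) (h * (lam * _ * _)) (h * (eps * _)).
by move: (V lam x) => *; lra.
Qed.


Variable T : R -> (R -> 'cV[R[i]]_n) -> (R -> 'cV[R[i]]_n).
Hypothesis cT : contraction_semigroup K L2K (L2_eq a b) normX T.
Hypothesis genT : generates L2K normX (port_hamiltonian a b K P1 P0 H WB) T.

Lemma energy1_le t f : 0 <= t -> L2K f -> E1 (T t f) <= E1 f.
Proof.
move=> t0 fK; rewrite -!sqr_Xnorm lerXn2r ?nnegrE ?sqrtr_ge0//.
exact: (sg_nrm_le L2_seminormed cT).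
Qed.

(** The interior energy V can only leak into the boundary layer at rate
lam (b - a) C times what is already there. The quantity N0 - V (x(t)) is used
instead of the boundary layer energy itself: it dominates the latter because the
norm does not increase, and this spares a discussion of the boundary terms. *)
Lemma wgt_energy_growth lam C x0 g0 : 0 <= lam -> 0 <= C ->
  P1^T = P1 -> P0^T = - P0 ->
  (forall z u, z \in `[a, b] -> `|cdot (H z *m P1 *m H z) u u| <= C * cdot (H z) u u) ->
  port_hamiltonian a b K P1 P0 H WB x0 g0 ->
  forall t, 0 <= t ->
  E1 x0 - expR (lam * ((b - a) * C) * t) * energy a b (wgt a b lam) H x0 x0
    <= E1 (T t x0).
Proof.
move=> lam0 C0 sP1 sP0 HC ph0 t t0.
have [xK gK _] := ph0; have snc := L2_seminormed.
have gen0 := (genT x0 g0).2 ph0.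
have T2 s f : 0 <= s -> L2K f -> L2vec a b (T s f).
  by move=> s0 fK; exact: L2_L2vec (sg_X cT s0 fK).
have cv : {within `[a, b], continuous (cwgt a b lam)}.
  by apply: continuous_subspaceT; exact: continuous_cwgt.
pose u s := E1 x0 - V lam (T s x0).
have VT0 : V lam (T 0 x0) = V lam x0.
  have [sg _] := cT; apply: energy_ae => //; [exact: T2|exact: L2_L2vec xK|].
  exact: (sg_zero sg).
have Wx0 : u 0 = energy a b (wgt a b lam) H x0 x0.
  rewrite /u VT0 energy_cwgt//; last exact: L2_L2vec xK.
  by rewrite opprB addrCA subrr addr0.
have w0 : 0 <= energy a b (wgt a b lam) H x0 x0.
  by apply: energy_ge0 => // z _; exact: wgt_ge0.
have VE f : L2vec a b f -> V lam f <= E1 f.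
  move=> f2; rewrite energy_cwgt// gerBl.
  by apply: energy_ge0 => // z _; exact: wgt_ge0.
have N1 : 0 < E1 x0 + 1 by rewrite ltr_wpDl// energy1_ge0.
rewrite -Wx0 lerBlDl -lerBlDr; apply: (@le_trans _ _ (u t)).
  by apply: lerB => //; apply: VE; exact: T2.
apply: Gronwall => //.
- by rewrite !mulr_ge0// subr_ge0 ltW.
- by rewrite Wx0.
move=> e e0; pose eps := e / (E1 x0 + 1).
have eps0 : 0 < eps by rewrite divr_gt0.
have [eta eta0 Heta] := generator_uniform snc cT gen0 eps0.
exists eta => // s h s0 hh; have /andP[h0 _] := hh.
pose r : R -> 'cV[R[i]]_n := (h^-1)%:C%C *: (T (s + h) x0 - T s x0) - T s g0.
have sh0 : 0 <= s + h by rewrite addr_ge0// ltW.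
have r2 : L2vec a b r.
  have := L2vec_lin (-1) (T2 _ _ s0 gK) (L2vec_lin h^-1
    (L2vec_lin (-1) (T2 _ _ s0 xK) (T2 _ _ sh0 xK)) (L2_L2vec (snc_zero snc))).
  by rewrite rmorphN1 !scaleN1r addr0 addrC [- T s x0 + _]addrC.
have rE : T (s + h) x0 = h%:C%C *: (T s g0 + r) + T s x0.
  rewrite /r addrC [T s g0 + _]addrC subrK scalerA -rmorphM mulfV ?gt_eqF//.
  by rewrite rmorph1 scale1r addrC subrK.
have phs := (genT _ _).1 (generator_invariant snc cT s0 gen0).
have reps : E1 r <= eps ^+ 2.
  by rewrite -sqr_Xnorm lerXn2r ?nnegrE ?sqrtr_ge0//; [exact: ltW|exact: Heta].
have := cwgt_energy_step lam0 C0 h0 eps0 sP1 sP0 HC phs r2 (energy1_le s0 xK) reps.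
rewrite -rE /u.
have -> : h * (eps * (E1 x0 + 1)) = e * h by rewrite mulrC /eps divfK ?gt_eqF.
move: (V lam (T s x0)) (V lam (T (s + h) x0)) (E1 x0) => v1 v2 N; lra.
Qed.

End PortHamiltonianSemigroup.


Theorem proposition4 (R : realType) (a b : R) (n : nat) (K : set R[i])
    (P1 P0 : 'M[R]_n) (H : R -> 'M[R]_n) (WB : 'M[R]_(n, n + n))
    (T : R -> (R -> 'cV[R[i]]_n) -> (R -> 'cV[R[i]]_n)) :
  a < b -> (1 <= n)%N ->
  K = range (real_complex R) \/ K = [set: R[i]] ->
  boundary_assumption WB ->
  hamiltonian_assumption a b H ->
  structure_assumption P1 P0 ->
  contraction_semigroup K (L2 a b K) (L2_eq a b) (Xnorm a b H) T ->
  generates (L2 a b K) (Xnorm a b H) (port_hamiltonian a b K P1 P0 H WB) T ->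
  exists tau : R, 0 < tau /\
    forall t : R, 0 <= t <= tau -> opnorm (L2 a b K) (Xnorm a b H) (T t) = 1.
Proof.
move=> ab n0 K_field _ [HC1 sH [m [M [m0 M0 Hm]]]] [sP1 _ sP0] cT genT.
have mH z : z \in `[a, b] -> loewner_le m%:M (H z) by move=> /Hm[].
have cH : continuous_mx a b H by have [dH HdH] := HC1 => i j; have [] := HdH i j.
have H0 z u : z \in `[a, b] -> 0 <= cdot (H z) u u.
  move=> zab; apply: le_trans (loewner_cdot u (mH z zab)).
  by rewrite mulr_ge0 ?sqnorm_ge0// ltW.
have snc := L2_seminormed K_field cH.
have [C C0 HC] := cdot_relative_bound m0 mH
  (continuous_mxM (continuous_mxM cH (@continuous_mx_cst R a b n n P1)) cH).
have [x0 [g0 [ph0 xfar xpos]]] := ex_interior_domain ab (K_real K_field) P1 P0 WB n0 HC1 m0 mH.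
have [xK _ _] := ph0; have d0 := margin_gt0 ab.
have L0 : 0 < b - a by rewrite subr_gt0.
(* The factor 2 leaves half of the margin at time tau. *)
pose tau := margin a b / (2 * ((b - a) * C)).
exists tau; split; first by rewrite divr_gt0// !mulr_gt0.
move=> t /andP[t0 tt].
apply: (opnorm_eq1 snc cT t0 xK); first by rewrite XnormE sqrtr_gt0.
rewrite !XnormE ler_wsqrtr//.
set N := energy _ _ _ _ x0 x0 in xpos *; set Nt := energy _ _ _ _ (T t x0) _.
rewrite leNgt; apply/negP => lt.
have D0 : 0 < N - Nt by rewrite subr_gt0.
(* Were energy lost, this lam would make exp (- lam * margin / 2) = exp (- N / (N - Nt)),
   which is less than the lost fraction (N - Nt) / N. *)
pose lam := 2 * N / (margin a b * (N - Nt)).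
have lam0 : 0 <= lam by apply: ltW; apply: divr_gt0; apply: mulr_gt0.
have := wgt_energy_growth ab K_field cH sH H0 cT genT lam0 (ltW C0) sP1 sP0 HC ph0 t0.
apply/negP; rewrite -ltNge -/N -/Nt.
have W0 := energy_wgt_le lam0 cH (L2_L2vec xK) H0 xfar.
rewrite ltrBrDr addrC -ltrBrDr.
apply: (@le_lt_trans _ _ (expR (lam * ((b - a) * C) * t) * (expR (- lam * margin a b) * N))).
  by rewrite ler_wpM2l ?expR_ge0.
rewrite mulrA -expRD.
have E1 : lam * ((b - a) * C) * t + - lam * margin a b <= - (N / (N - Nt)).
  have : lam * ((b - a) * C) * t <= lam * (margin a b / 2).
    rewrite -mulrA ler_wpM2l//.
    move: tt; rewrite /tau ler_pdivlMr ?mulr_gt0// => tt; lra.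
  have : lam * margin a b = 2 * (N / (N - Nt)) by rewrite /lam; field; rewrite !gt_eqF.
  lra.
have E2 : expR (lam * ((b - a) * C) * t + - lam * margin a b) <= (1 + N / (N - Nt))^-1.
  apply: (@le_trans _ _ (expR (- (N / (N - Nt))))); first by rewrite ler_expR.
  rewrite expRN lef_pV2 ?posrE ?expR_gt0 ?expR_ge1Dx//.
  by rewrite addr_gt0// divr_gt0.
apply: le_lt_trans (ler_wpM2r (ltW xpos) E2) _.
rewrite mulrC ltr_pdivrMr ?addr_gt0 ?divr_gt0//.
by rewrite mulrDr mulr1 mulrC divfK ?gt_eqF// ltrDr.
Qed.
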